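(* Let $(\mathcal{N},\|\cdot\|)$ be a real normed space, endowed with its norm topology and Borel $\sigma$-algebra $\mathcal{B}$, such that the addition $(x,y)\mapsto x+y$ is measurable from $(\mathcal{N}^2,\mathcal{B}\otimes\mathcal{B})$ to $(\mathcal{N},\mathcal{B})$ (a measurable normed space). Let $(X_n)_{n\ge1}$ be a sequence of independent and identically distributed $(\mathcal{N},\mathcal{B})$-valued random variables and $\overline{X}_n=(X_1+\dots+X_n)/n$. Then $(\overline{X}_n,n)_{n\ge1}$ satisfies a weak large deviation principle, and its entropy satisfies $s=-p^*$, where $p(\lambda)=\log\mathbb{E}(e^{\lambda(X_1)})$ for $\lambda\in\mathcal{N}^*$.
   Context: $\mathcal{N}^*$ is the topological dual. Entropy: $s(x)=\inf_{r>0}\liminf_n\frac1n\log\mathbb{P}(\overline{X}_n\in B(x,r))$, with $B(x,r)$ the open ball. $p^*(x)=\sup_{\lambda\in\mathcal{N}^*}(\lambda(x)-p(\lambda))$. Weak large deviation principle: (i) for every Borel $G$, $\liminf_n\frac1n\log\mathbb{P}(\overline{X}_n\in G)\ge\sup_{x\in\mathrm{int}\,G}s(x)$; (ii) for every Borel relatively compact $K$, $\limsup_n\frac1n\log\mathbb{P}(\overline{X}_n\in K)\le\sup_{x\in\overline{K}}s(x)$. *)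

(* Defs.v *)
From HB Require Import structures.
From mathcomp Require Import all_boot all_order all_algebra.
From mathcomp Require Import all_classical all_reals all_analysis.
Set Implicit Arguments. Unset Strict Implicit. Unset Printing Implicit Defensive.
Import Order.TTheory GRing.Theory Num.Theory.
Import numFieldNormedType.Exports.
Local Open Scope classical_set_scope.
Local Open Scope ring_scope.

Section Defs.
Variables (R : realType) (V : normedModType R).

Definition borel_set : set (set V) := <<s [set G : set V | open G] >>.

Definition borel_prod : set (set (V * V)) :=
  <<s [set C | exists A B, borel_set A /\ borel_set B /\ C = A `*` B] >>.

Definition measurable_addition : Prop :=
  forall A, borel_set A -> borel_prod [set xy : V * V | xy.1 + xy.2 \in A].

Definition top_dual : set (V -> R) :=
  [set l | (forall (a : R) (u v : V), l (a *: u + v) = a * l u + l v)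
           /\ continuous l].

Variables (d : measure_display) (T : measurableType d) (P : probability T R).

Definition borel_rv (Y : T -> V) : Prop :=
  forall A, borel_set A -> measurable (Y @^-1` A).

Definition mutually_independent (X : nat -> T -> V) : Prop :=
  forall (I : seq nat) (A : nat -> set V), uniq I ->
    (forall i, i \in I -> borel_set (A i)) ->
    P (\bigcap_(i in [set` I]) (X i @^-1` A i)) =
      (\prod_(i <- I) P (X i @^-1` A i))%E.

Definition identically_distributed (X : nat -> T -> V) : Prop :=
  forall i A, borel_set A -> P (X i @^-1` A) = P (X 0%N @^-1` A).

(* empirical mean: Xbar_n = (X_1 + ... + X_n)/n, where X_{k+1} is X k *)
Definition emp_mean (X : nat -> T -> V) (n : nat) (w : T) : V :=
  (n%:R)^-1 *: \sum_(i < n) X i w.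

Definition elog (x : \bar R) : \bar R :=
  match x with
  | r%:E => if 0 < r then (ln r)%:E else -oo%E
  | +oo%E => +oo%E
  | -oo%E => -oo%E
  end.

(* n |-> (1/n) log P(Xbar_n in G), for n >= 1 (indexed by n.+1) *)
Definition ld_seq (X : nat -> T -> V) (G : set V) (n : nat) : \bar R :=
  ((n.+1%:R)^-1)%:E * elog (P (emp_mean X n.+1 @^-1` G)).

Definition entropy (X : nat -> T -> V) (x : V) : \bar R :=
  ereal_inf [set limn_einf (ld_seq X (ball x r)) | r in [set r : R | 0 < r]].

Definition log_mgf (X : nat -> T -> V) (l : V -> R) : \bar R :=
  elog (\int[P]_w (expR (l (X 0%N w)))%:E).

Definition legendre (X : nat -> T -> V) (x : V) : \bar R :=
  ereal_sup [set ((l x)%:E - log_mgf X l)%E | l in top_dual].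

Definition weak_LDP (X : nat -> T -> V) (s : V -> \bar R) : Prop :=
  (forall G, borel_set G ->
     (ereal_sup (s @` interior G) <= limn_einf (ld_seq X G))%E) /\
  (forall K, borel_set K -> compact (closure K) ->
     (limn_esup (ld_seq X K) <= ereal_sup (s @` closure K))%E).

End Defs.

(* Main.v *)
Require Import Defs.
From HB Require Import structures.
From mathcomp Require Import all_boot all_order all_algebra.
From mathcomp Require Import all_classical all_reals all_analysis.
From mathcomp Require Import wochoice measurable_realfun.
From mathcomp Require Import ring lra.
Import Order.TTheory GRing.Theory Num.Theory.
Import numFieldNormedType.Exports.
Local Open Scope classical_set_scope.
Local Open Scope ring_scope.

Set Implicit Arguments.
Unset Strict Implicit.
Unset Printing Implicit Defensive.

(** Measurability of the addition forces the law of X_1 to be carried by a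
    separable set: along a well-ordered family of vectors d_i, each at distance
    1 from the span of the previous ones, all sets of points d_i + 4 d_j are
    closed, so that {(i, j) | i < j} would be product-measurable for an atomless
    law on the indices, against Fubini.  Hence X_1 can be replaced, up to a small
    error e, by a variable with countably many values, and the sums of n such
    variables, restricted to the first m values, are finite random walks.

    If (1/n) log P(Xbar_n in B(x, r)) < c <= 0 infinitely often, then
    supermultiplicativity bounds the mass that the n-step walk centred at x gives
    to v by exp (c n + M |v|), with M proportional to - c / r.  A form of
    Hahn-Banach on the additive monoid generated by the pairs
    (v, c n - log mass) yields l in the dual with |l| <= M such that the mass is
    at most exp (c n - l v) for all m, n and v.  An n-step walk on m letters takes
    polynomially many values, so E exp (l (X_1 - x)) <= exp (c + M e); letting e
    tend to 0 gives - p^* x <= c, hence - p^* <= s.  Chernoff's bound gives the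
    converse inequality and, with a finite cover, the upper bound on compact
    sets. *)

(** * Linear functionals dominated on an additive monoid *)

(** For fixed [u] the defect [f b = l (b *: u) - b * l u] is additive, vanishes at integers and is
    bounded on [0, 1], hence everywhere by [K]. Since [f (a *+ n) = f a *+ n] stays below [K] for
    every [n], it is zero. *)
Lemma additive_bounded_linear (R : realType) (V : normedModType R) (l : V -> R)
    (M : R) : (forall u v, l (u + v) = l u + l v) ->
  (forall v, `|l v| <= M * `|v|) ->
  forall a u v, l (a *: u + v) = a * l u + l v.
Proof.
move=> lD lM a u v; rewrite lD; congr (_ + _).
have l0 : l 0 = 0 by have := lD 0 0; rewrite addr0; lra.
pose f b := l (b *: u) - b * l u.
have fD b c : f (b + c) = f b + f c by rewrite /f scalerDl lD; ring.
have f0 : f 0 = 0 by rewrite /f scale0r l0; ring.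
have fN b : f (- b) = - f b.
  by have := fD b (- b); rewrite addrN f0; lra.
have fMn b n : f (b *+ n) = f b *+ n.
  by elim: n => [|n IH]; rewrite ?mulr0n ?f0// !mulrSr fD IH.
have f1 : f 1 = 0 by rewrite /f scale1r; ring.
have fz (z : int) : f z%:~R = 0.
  by case: z => n; rewrite ?NegzE ?mulrNz ?fN -pmulrn fMn f1 mul0rn ?oppr0.
pose K := M * `|u| + `|l u|.
have fK b : 0 <= b <= 1 -> `|f b| <= K.
  move=> /andP[b0 b1]; apply: (le_trans (ler_normB _ _)).
  rewrite /K lerD //; last by rewrite normrM ger0_norm// ler_piMl.
  apply: (le_trans (lM _)); rewrite normrZ (ger0_norm b0).
  by rewrite mulrCA ler_piMl// (le_trans _ (lM u)).
have key n : `|f a| *+ n <= K.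
  rewrite -normrMn -fMn.
  have -> : f (a *+ n) = f (a *+ n - (Num.floor (a *+ n))%:~R).
    by rewrite fD fN fz oppr0 addr0.
  apply: fK; rewrite subr_ge0 floor_le /=.
  by have := floorD1_gt (a *+ n); rewrite intrD; lra.
have : f a = 0.
  apply/eqP/negPn/negP => fa0.
  have fa_gt0 : 0 < `|f a| by rewrite normr_gt0.
  have := key (Num.truncn (K / `|f a|)).+1.
  rewrite -mulr_natr leNgt mulrC -ltr_pdivrMr//.
  by rewrite truncnS_gt.
by rewrite /f; lra.
Qed.

(* Hahn-Banach in the form of a Zorn argument on additive submonoids of V * R:
   a maximal one contains (v, a) or (- v, - a) for every (v, a). *)
Lemma submonoid_dominating_functional (R : realType) (V : normedModType R)
    (G0 : set (V * R)) (M : R) : 0 <= M ->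
  G0 0 -> (forall x y, G0 x -> G0 y -> G0 (x + y)) ->
  (forall x, G0 x -> 0 <= M * `|x.1| + x.2) ->
  exists l : V -> R, [/\ forall a u v, l (a *: u + v) = a * l u + l v,
    forall v, `|l v| <= M * `|v| & forall x, G0 x -> l x.1 <= x.2].
Proof.
move=> M0 G00 G0D G0M.
(* [B] is [G0] plus the cone of pairs [(u, k)] with [k] at least [M] times the norm of [u]:
   dominating [B] gives the norm bound on [l] together with the bound on [G0]. *)
pose B : set (V * R) := [set x | exists y u k,
  [/\ G0 y, M * `|u| <= k & x = (y.1 + u, y.2 + k)]].
have B0 : B 0 by exists 0, 0, 0; rewrite normr0 mulr0 !addr0.
have BD x y : B x -> B y -> B (x + y).
  move=> [x1 [u [k [Gx uk ->]]]] [x2 [u' [k' [Gy uk' ->]]]].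
  exists (x1 + x2), (u + u'), (k + k'); split; first exact: G0D.
    by have := ler_wpM2l M0 (ler_normD u u'); lra.
  by rewrite /= /GRing.add /= /add_pair /=; congr pair;
    [rewrite addrACA|rewrite addrACA].
have Bpos h : B (0, h) -> 0 <= h.
  move=> [y [u [k [Gy uk [yu ->]]]]].
  have := G0M _ Gy; have -> : y.1 = - u by apply/eqP; rewrite -addr_eq0 -yu.
  by rewrite normrN; lra.
pose good (G : set (V * R)) := (forall x y, G x -> G y -> G (x + y)) /\
  (forall h, G (0, h) -> 0 <= h).
(* The condition bears on the union of [B] and [A], not on [A] alone, so that the empty chain also
   satisfies it. *)
have [A [[AD Apos] Amax]] : exists A, good (B `|` A) /\
    forall A', A `<` A' -> ~ good (B `|` A').
  apply: (@Zorn_bigcup _ (fun A => good (B `|` A))) => F Fgood Ftot.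
  have common x y : (B `|` \bigcup_(X in F) X) x -> (B `|` \bigcup_(X in F) X) y ->
      (B x /\ B y) \/ exists2 X, F X & (B `|` X) x /\ (B `|` X) y.
    move=> [Bx|[X FX Xx]] [By|[Y FY Yy]].
    - by left.
    - by right; exists Y => //; split; [left|right].
    - by right; exists X => //; split; [right|left].
    - right; have [XY|YX] := Ftot _ _ FX FY.
        by exists Y => //; split; right => //; exact: XY.
      by exists X => //; split; right => //; exact: YX.
  split=> [x y|h] Ax.
    move=> Ay; have [[Bx By]|[X FX [Xx Xy]]] := common _ _ Ax Ay.
      by left; exact: BD.
    by have [/(_ _ _ Xx Xy)[?|?] _] := Fgood _ FX; [left|right; exists X].
  have [[/Bpos//]|[X FX [Xx _]]] := common _ _ Ax Ax.
  by have [_ /(_ _ Xx)] := Fgood _ FX.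
set G := B `|` A in AD Apos.
have G_0 : G 0 by left.
have GMn x n : G x -> G (x *+ n).
  by move=> Gx; elim: n => [|n IH]; rewrite ?mulr0n// mulrS; exact: AD.
(* Adjoining the multiples of [x] to the maximal [G] must break positivity, which exhibits some
   [y + x *+ n] equal to [(0, h)] with [h < 0]. *)
have Gext x : ~ G x -> exists n y, [/\ G y, y.1 = - x.1 *+ n & y.2 + x.2 *+ n < 0].
  move=> nGx; apply: contrapT => H.
  pose G' := [set z | exists n y, G y /\ z = y + x *+ n].
  have GG' : G `<=` G' by move=> z Gz; exists 0%N, z; rewrite mulr0n addr0.
  have BG' : B `|` G' = G'.
    by apply/seteqP; split=> [z [Bz|]|z]; [apply: GG'; left|by []|by right].
  apply: (Amax G').
    split=> [z Az|]; first by apply: GG'; right.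
    move=> /(_ x); apply: contra_not _ nGx => H'; right; apply: H'.
    by exists 1%N, 0; rewrite add0r mulr1n.
  rewrite BG'; split=> [_ _ [n [y [Gy ->]]] [n' [y' [Gy' ->]]]|h].
    exists (n + n')%N, (y + y'); split; first exact: AD.
    by rewrite mulrnDr addrACA.
  move=> [n [y [Gy e]]]; rewrite leNgt; apply/negP => h0; apply: H.
  exists n, y; split => //.
    have /= /esym/eqP := congr1 fst e.
    by rewrite addr_eq0 mulNrn => /eqP ->; congr (- _);
      elim: n {e} => // n IH; rewrite !mulrS /= IH.
  have /= := congr1 snd e.
  suff -> : (x *+ n).2 = x.2 *+ n by move=> <-.
  by elim: n {e} => // n IH; rewrite !mulrS /= IH.
have pairMn (x : V * R) n : x *+ n = (x.1 *+ n, x.2 *+ n).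
  by elim: n => // n IH; rewrite !mulrS IH.
(* If both were missing, multiples of the two witnesses would add up so that [x] cancels, leaving in
   [G] a pair [(0, h)] with [h < 0]. When [n = 0], [y] itself is such a pair. *)
have Gdich x : G x \/ G (- x).
  apply: contrapT => /not_orP[/Gext[n [y [Gy y1 y2]]] /Gext[m [z [Gz z1 z2]]]].
  have : G (y *+ m + z *+ n) by apply: AD; exact: GMn.
  rewrite !pairMn /GRing.add /= /add_pair /= y1 z1 /= opprK.
  rewrite -!mulrnA mulnC mulNrn addNr => /Apos.
  rewrite leNgt => /negP; apply.
  case: n => [|n] in y1 y2 z1 z2 *.
    have : G (0, y.2) by move: Gy; case: (y) y1 => a b /= ->; rewrite mulr0n.
    by move=> /Apos; move: y2; rewrite mulr0n; lra.
  rewrite -(mulr_natr x.2) in y2; rewrite -(mulr_natr (- x.2)) in z2.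
  rewrite -[y.2 *+ _]mulr_natr -[z.2 *+ _]mulr_natr.
  have m0 : 0 <= m%:R :> R by [].
  have n0 : 0 < n.+1%:R :> R by [].
  apply: (@le_lt_trans _ _ (- (x.2 * n.+1%:R) * m%:R + z.2 * n.+1%:R)).
    by rewrite lerD2r ler_wpM2r//; lra.
  by rewrite mulNr -mulrA [n.+1%:R * _]mulrC mulrA -mulNr -mulrDl pmulr_llt0//; move: z2; lra.
have Gnorm v h : M * `|v| <= h -> G (v, h).
  by move=> vh; left; exists 0, v, h; split => //; rewrite !add0r.
have Glow v h : G (v, h) -> - (M * `|v|) <= h.
  move=> Gv; have : G ((v, h) + (- v, M * `|v|)).
    by apply: AD => //; apply: Gnorm; rewrite normrN.
  by rewrite /GRing.add /= /add_pair /= addrN => /Apos; lra.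
pose S v := [set h | G (v, h)].
pose l v := inf (S v).
have Sinf v : has_inf (S v).
  split; first by exists (M * `|v|); apply: Gnorm.
  by exists (- (M * `|v|)) => h; exact: Glow.
have lG x : G x -> l x.1 <= x.2.
  by case: x => v h Gx; apply: ge_inf => //; exact: (Sinf v).2.
have l_ge v a : (forall h, G (v, h) -> a <= h) -> a <= l v.
  by move=> H; apply: lb_le_inf => //; exact: (Sinf v).1.
have lsub u v : l (u + v) <= l u + l v.
  rewrite -lerBlDr; apply: (l_ge u _) => h Gu; rewrite lerBlDr -lerBlDl.
  apply: (l_ge v _) => k Gv; rewrite lerBlDl.
  exact: (lG ((u, h) + (v, k))) (AD _ _ Gu Gv).
(* Otherwise take [b] midway between [- l v] and [l (- v)]: by the dichotomy [(- v, b)] or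
   [(v, - b)] is in [G], and each contradicts an infimum. *)
have lN v : l (- v) <= - l v.
  rewrite leNgt; apply/negP => hl.
  pose b := (- l v + l (- v)) / 2.
  have [/lG /=|] := Gdich (- v, b); first by rewrite /b; lra.
  have -> : - (- v, b) = (v, - b) by rewrite -[v in RHS]opprK.
  by move=> /lG /=; rewrite /b; lra.
have lD u v : l (u + v) = l u + l v.
  apply/eqP; rewrite eq_le lsub /=.
  by have := lsub (u + v) (- v); rewrite addrK; have := lN v; lra.
have lM v : `|l v| <= M * `|v|.
  rewrite ler_norml; apply/andP; split; last exact: (lG (v, _)) (Gnorm _ _ _).
  by apply: (l_ge v _) => h; exact: Glow.
exists l; split => //; first exact: additive_bounded_linear lM.
move=> [v h] Gv; apply: lG; left; exists (v, h), 0, 0.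
by rewrite normr0 mulr0 /= !addr0.
Qed.


(** * Borel sets and Borel variables *)

Lemma measurable_preimage_generated d (T : measurableType d) (U : Type)
    (G : set (set U)) (Y : T -> U) :
  (forall A, G A -> measurable (Y @^-1` A)) ->
  forall A, <<s G >> A -> measurable (Y @^-1` A).
Proof.
move=> GY; apply: smallest_sub => //; split=> [|A mA|F mF] /=.
- by rewrite preimage_set0.
- by rewrite setTD preimage_setC; exact: measurableC.
- by rewrite preimage_bigcup; exact: bigcupT_measurable.
Qed.

Lemma open_borel_set (R : realType) (V : normedModType R) (A : set V) :
  open A -> borel_set A.
Proof. exact: sub_sigma_algebra. Qed.

Lemma borel_setC (R : realType) (V : normedModType R) (A : set V) :
  borel_set A -> borel_set (~` A).
Proof. by move=> bA; rewrite -setTD; exact: sigma_algebraCD. Qed.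

Lemma closed_borel_set (R : realType) (V : normedModType R) (A : set V) :
  closed A -> borel_set A.
Proof. 
by move=> cA; rewrite -[A]setCK; apply: borel_setC; apply: open_borel_set; exact: closed_openC. Qed.

Lemma borel_set_bigcup (R : realType) (V : normedModType R) (F : nat -> set V) :
  (forall n, borel_set (F n)) -> borel_set (\bigcup_n F n).
Proof. exact: sigma_algebra_bigcup. Qed.

Lemma borel_setU (R : realType) (V : normedModType R) (A B : set V) :
  borel_set A -> borel_set B -> borel_set (A `|` B).
Proof.
move=> bA bB; rewrite -bigcup2E.
apply: borel_set_bigcup => -[|[|n]] //=.
by apply: closed_borel_set; exact: closed0.
Qed.

Lemma borel_setD (R : realType) (V : normedModType R) (A B : set V) :
  borel_set A -> borel_set B -> borel_set (A `\` B).
Proof.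
move=> bA bB; rewrite -[_ `\` _]setCK setCD.
by apply: borel_setC; apply: borel_setU => //; exact: borel_setC.
Qed.

Lemma borel_set_bigsetU (R : realType) (V : normedModType R) (A : nat -> set V)
    (m : nat) :
  (forall k, borel_set (A k)) -> borel_set (\big[setU/set0]_(k < m) A k).
Proof.
move=> bA; elim/big_ind : _ => //; last exact: borel_setU.
by apply: closed_borel_set; exact: closed0.
Qed.

Lemma borel_rv_open (R : realType) (V : normedModType R) d
    (T : measurableType d) (Y : T -> V) :
  (forall A, open A -> measurable (Y @^-1` A)) -> borel_rv Y.
Proof. exact: measurable_preimage_generated. Qed.

Lemma borel_rv_continuous (R : realType) (V : normedModType R) d
    (T : measurableType d) (Y : T -> V) (h : V -> V) :
  continuous h -> borel_rv Y -> borel_rv (h \o Y).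
Proof.
move=> ch bY; apply: borel_rv_open => A oA; rewrite comp_preimage.
by apply: bY; apply: open_borel_set; apply: open_comp => // x _; exact: ch.
Qed.

Lemma borel_rvD (R : realType) (V : normedModType R) d
    (T : measurableType d) (f g : T -> V) :
  measurable_addition V -> borel_rv f -> borel_rv g ->
  borel_rv (fun w => f w + g w).
Proof.
move=> mD bf bg A /mD bA.
rewrite (_ : _ @^-1` _ = (fun w => (f w, g w)) @^-1` [set xy | xy.1 + xy.2 \in A]).
  by apply: measurable_preimage_generated bA => _ [B [C [bB [bC ->]]]];
    apply: measurableI; [exact: bf|exact: bg].
by apply/seteqP; split=> w /=; rewrite in_setE.
Qed.

Lemma borel_rv_emp_mean (R : realType) (V : normedModType R) d
    (T : measurableType d) (X : nat -> T -> V) n :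
  measurable_addition V -> (forall i, borel_rv (X i)) -> borel_rv (emp_mean X n).
Proof.
move=> mD bX; apply: (@borel_rv_continuous _ _ _ _ (fun w => \sum_(i < n) X i w)
  (fun v => n%:R^-1 *: v)).
  by move=> v; exact: scaler_continuous.
elim: n => [|n IH].
  apply: borel_rv_open => A _; have [A0|nA0] := pselect (A 0).
    rewrite (_ : _ @^-1` _ = setT) //; apply/seteqP; split=> // w _ /=.
    by rewrite big_ord0.
  rewrite (_ : _ @^-1` _ = set0) //; apply/seteqP; split=> // w /=.
  by rewrite big_ord0.
rewrite (_ : (fun w => _) = (fun w => \sum_(i < n) X i w + X n w)).
  exact: borel_rvD.
by apply/funext => w; rewrite big_ord_recr.
Qed.

(** * Well-orders, separated families and separability of the law *)

(** A ball of radius [e / 2] meets at most one member of the family, so a limit point of the union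
    is a limit point of a single closed member. The index set may be uncountable, which is what
    makes huge unions Borel below. *)
Lemma closed_bigcup_separated (R : realType) (V : normedModType R) (I : Type)
    (S : set I) (Z : I -> set V) (e : R) : 0 < e ->
  (forall i, S i -> closed (Z i)) ->
  (forall i j x y, S i -> S j -> Z i x -> Z j y -> `|x - y| < e -> i = j) ->
  closed (\bigcup_(i in S) Z i).
Proof.
move=> e0 cZ sepZ x cx.
have e20 : 0 < e / 2 by rewrite divr_gt0.
have [y [[i Si Zy] xy]] := cx _ (nbhsx_ballx x _ e20).
exists i => //; apply: cZ => // B Bx.
have [z [[j Sj Zz] [Bz xz]]] := cx _ (filterI Bx (nbhsx_ballx x _ e20)).
suff ij : i = j by exists z; split=> //; rewrite ij.
apply: sepZ Zy Zz _ => //.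
rewrite -ball_normE /= in xy xz.
rewrite (_ : y - z = (x - z) - (x - y)); last by rewrite opprB [RHS]addrC subrKA.
by apply: (le_lt_trans (ler_normB _ _)); lra.
Qed.

Definition strict_well_order (T : Type) (lt : T -> T -> Prop) : Prop :=
  [/\ forall x, ~ lt x x,
      forall x y z, lt x y -> lt y z -> lt x z,
      forall x y, [\/ lt x y, x = y | lt y x] &
      forall A : set T, A !=set0 -> exists2 m, A m & forall x, lt x m -> ~ A x].

Lemma strict_well_order_exists (T : eqType) :
  exists lt : T -> T -> Prop, strict_well_order lt.
Proof.
have [r wo] := well_ordering_principle T.
have woC : wo_chain r predT by move=> A _; exact: wo.
have rtot : forall x y, r x y || r y x by move=> x y; exact: (wo_chainW woC).
have ranti x y : r x y -> r y x -> x = y.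
  by move=> xy yx; apply: (wo_chain_antisymmetric woC) => //; rewrite xy yx.
have rmin (A : set T) : A !=set0 -> exists2 m, A m & forall x, A x -> r m x.
  move=> [a Aa]; have [|m [[mA mlb] _]] := wo (fun x => `[< A x >]).
    by exists a; apply/asboolP.
  by exists m => [|x Ax]; [exact/asboolP|apply: mlb; apply/asboolP].
(* Transitivity is read off the least element of the three points. *)
have rtrans x y z : r x y -> r y z -> r x z.
  move=> xy yz; have [|m Am mlb] := rmin [set x; y; z]; first by exists x; left; left.
  have mx : r m x by apply: mlb; left; left.
  have my : r m y by apply: mlb; left; right.
  have mz : r m z by apply: mlb; right.
  move: Am => [[mE|mE]|mE]; rewrite mE in mx my mz => //.
    by have -> : x = y by exact: ranti.
  have yE : y = z by exact: ranti.
  by rewrite -yE.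
exists (fun x y => r x y /\ x <> y); split=> [x []//|x y z [xy nxy] [yz nyz]|x y|A /rmin[m Am mlb]].
- split; first exact: rtrans yz.
  by move=> xz; apply: nxy; apply: ranti => //; rewrite xz.
- have [->|/eqP nxy] := eqVneq x y; first by constructor 2.
  have /orP[?|?] := rtot x y; first by constructor 1.
  by constructor 3; split => // yx; apply: nxy.
- by exists m => // x [xm nxm] Ax; apply: nxm; apply: ranti => //; exact: mlb.
Qed.

(* [f v] stays at distance 1 from the subspace [L v], which contains [f u] for
   every earlier index [u]. *)
Definition separated_family (R : realType) (V : normedModType R)
    (lt : V -> V -> Prop) (I : set V) (L : V -> set V) (f : V -> V) : Prop :=
  [/\ forall v x y, L v x -> L v y -> L v (x + y),
      forall v c x, L v x -> L v (c *: x),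
      forall u v, I u -> lt u v -> L v (f u) &
      forall v c x, I v -> L v x -> `|c| <= `|c *: f v + x|].

(** After cancelling [j] against [j'] when they agree, the largest remaining index carries a total
    coefficient among 4, 3, 1, -1, -4, -5, and the other terms lie in its subspace [L], so the norm
    is at least 1. The weight 4 makes the pair ordered: with weight 1 exchanging [i] and [j] would
    give the same sum. *)
Lemma sum_scaled_separated (R : realType) (V : normedModType R)
    (lt : V -> V -> Prop) (I : set V) (L : V -> set V) (f : V -> V) :
  strict_well_order lt -> separated_family lt I L f ->
  forall i j i' j', I i -> I j -> I i' -> I j' -> lt i j ->
    `|(f i + 4 *: f j) - (f i' + 4 *: f j')| < 1 -> i = i' /\ j = j'.
Proof.
move=> [ltxx lttrans tri _] [LD LZ Lf Lsep] i j i' j' Ii Ij Ii' Ij' ij.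
have LN v x : L v x -> L v (- x) by rewrite -scaleN1r; exact: LZ.
have sep (c : R) v x (z : V) : I v -> L v x -> 1 <= `|c| -> z = c *: f v + x -> ~ (`|z| < 1).
  move=> Iv Lx c1 -> /lt_le_trans/(_ c1); rewrite ltNge.
  by apply/negP/negPn; exact: Lsep.
have n4 : 1 <= `|4| :> R by rewrite ger0_norm// ler1n.
have n1 : 1 <= `|-1| :> R by rewrite normrN1.
have n4' : 1 <= `|-4| :> R by rewrite normrN.
have n3 : 1 <= `|3| :> R by rewrite ger0_norm// ler1n.
have n5 : 1 <= `|-5| :> R by rewrite normrN ger0_norm// ler1n.
have -> : (f i + 4 *: f j) - (f i' + 4 *: f j') =
    1 *: f i + 4 *: f j + -1 *: f i' + -4 *: f j'.
  by rewrite scale1r scaleN1r scaleNr opprD addrA.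
have Ll u v (c : R) : I u -> lt u v -> L v (c *: f u) by move=> Iu uv; exact/LZ/Lf.
have [j'j|jj'|jj'] := tri j' j.
- have [i'j|i'j|ji'] := tri i' j.
  + move=> H; exfalso; move: H; apply: (@sep 4 j (1 *: f i + -1 *: f i' + -4 *: f j')) => //.
      by apply/LD; [apply/LD|]; exact: Ll.
    by rewrite [LHS](+%R.[ACl 2*(1*3*4)]).
  + subst i'; move=> H; exfalso; move: H; apply: (@sep 3 j (1 *: f i + -4 *: f j')) => //.
      by apply/LD; exact: Ll.
    rewrite [LHS](+%R.[ACl (2*3)*(1*4)]) /= -scalerDl.
    by congr (_ *: _ + _); ring.
  + have ii' := lttrans _ _ _ ij ji'; have j'i' := lttrans _ _ _ j'j ji'.
    move=> H; exfalso; move: H; apply: (@sep (-1) i' (1 *: f i + 4 *: f j + -4 *: f j')) => //.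
      by apply/LD; [apply/LD|]; exact: Ll.
    by rewrite [LHS](+%R.[ACl 3*(1*2*4)]).
- subst j'; have -> : 1 *: f i + 4 *: f j + -1 *: f i' + -4 *: f j = 1 *: f i + -1 *: f i'.
    by rewrite [LHS](+%R.[ACl (1*3)*(2*4)]) /= [-4 *: _]scaleNr addrN addr0.
  have [ii'|->//|i'i] := tri i i' => H; exfalso; move: H.
  + by apply: (@sep (-1) i' (1 *: f i)) => //; [exact: Ll|rewrite addrC].
  + by apply: (@sep 1 i (-1 *: f i')) => //; [exact: Ll|rewrite normr1].
- have ij' := lttrans _ _ _ ij jj'.
  have [i'j'|i'j'|j'i'] := tri i' j'.
  + move=> H; exfalso; move: H; apply: (@sep (-4) j' (1 *: f i + 4 *: f j + -1 *: f i')) => //.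
      by apply/LD; [apply/LD|]; exact: Ll.
    by rewrite addrC.
  + subst i'; move=> H; exfalso; move: H; apply: (@sep (-5) j' (1 *: f i + 4 *: f j)) => //.
      by apply/LD; exact: Ll.
    rewrite [LHS](+%R.[ACl (3*4)*(1*2)]) /= -scalerDl.
    by congr (_ *: _ + _); ring.
  + have ii' := lttrans _ _ _ ij' j'i'; have ji' := lttrans _ _ _ jj' j'i'.
    move=> H; exfalso; move: H; apply: (@sep (-1) i' (1 *: f i + 4 *: f j + -4 *: f j')) => //.
      by apply/LD; [apply/LD|]; exact: Ll.
    by rewrite [LHS](+%R.[ACl 3*(1*2*4)]).
Qed.

(** Exhaustion: some countable range attains the supremum of the masses of countable ranges, and
    adding a point [u] of positive mass to it would exceed that supremum. *)
Lemma sup_range_probability (R : realType) d (T : measurableType d)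
    (P : probability T R) (U : pointedType) (Y : T -> U) :
  (forall S : set U, measurable (Y @^-1` S)) ->
  exists e : nat -> U, forall u, ~ range e u -> P (Y @^-1` [set u]) = 0%E.
Proof.
move=> mY.
pose S := [set fine (P (Y @^-1` range e)) | e in [set: nat -> U]].
have Sup : has_sup S.
  split; first by exists (fine (P (Y @^-1` range (fun _ : nat => point : U)))), (fun=> point).
  by exists 1 => _ [e _ <-]; rewrite -lee_fin fineK ?fin_num_measure// probability_le1.
have /choice[e eP] : forall n : nat, exists e : nat -> U,
    sup S - n.+1%:R^-1 < fine (P (Y @^-1` range e)).
  move=> n; have n0 : 0 < n.+1%:R^-1 :> R by rewrite invr_gt0.
  by have [_ [e _ <-] ?] := sup_adherent n0 Sup; exists e.
pose e' n := if @unpickle (nat * nat)%type n is Some ij then e ij.1 ij.2 else point.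
have ee' n : range (e n) `<=` range e'.
  by move=> _ [k _ <-]; exists (pickle (n, k)) => //; rewrite /e' pickleK.
have e'sup : sup S <= fine (P (Y @^-1` range e')).
  apply/ler_addgt0Pr => r r0.
  have [n nr] : exists n, n.+1%:R^-1 < r.
    exists (Num.truncn r^-1); rewrite invf_plt ?posrE//; exact: truncnS_gt.
  have : fine (P (Y @^-1` range (e n))) <= fine (P (Y @^-1` range e')).
    rewrite fine_le ?fin_num_measure// le_measure ?inE//.
    by apply: preimage_subset; exact: ee'.
  move: (eP n) nr; set z := _^-1; move: z (fine _) (fine _) (sup _) => z x y s h1 h2 h3; lra.
exists e' => u ue'.
pose e1 n := if n is n'.+1 then e' n' else u.
have e1E : Y @^-1` range e1 = Y @^-1` [set u] `|` Y @^-1` range e'.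
  rewrite -preimage_setU; congr (_ @^-1` _); apply/seteqP; split.
    by move=> _ [[|n] _ <-]; [left|right; exists n].
  by move=> v [->|[n _ <-]]; [exists 0%N|exists n.+1].
have : fine (P (Y @^-1` range e1)) <= sup S.
  by apply: ub_le_sup; [exact: Sup.2|exists e1].
rewrite e1E measureU//; last first.
  by apply/seteqP; split=> // w [/= ->].
rewrite fineD ?fin_num_measure// => H.
have : fine (P (Y @^-1` [set u])) <= 0 by lra.
rewrite -lee_fin fineK ?fin_num_measure// => H0.
by apply/eqP; rewrite eq_le H0 measure_ge0.
Qed.

(* The set of pairs (w, w') with Y w before Y w' is measurable, since it is
   read off the Borel variable f (Y w) + 4 f (Y w'); if the initial segments of
   Y were null on a non-null event, this would contradict Fubini. *)
Lemma separated_family_countable (R : realType) (V : normedModType R) d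
    (T : measurableType d) (P : probability T R)
    (lt : V -> V -> Prop) (I : set V) (L : V -> set V) (f : V -> V) (Y : T -> V) :
  measurable_addition V -> strict_well_order lt -> separated_family lt I L f ->
  (forall S : set V, measurable (Y @^-1` S)) ->
  exists e : nat -> V, P (Y @^-1` (I `\` range e)) = 0%E.
Proof.
move=> mD wolt sepf mY.
have [ltxx lttrans tri wf] := wolt.
have [e eP] := sup_range_probability P mY; exists e.
apply: contrapT => PN.
set N := I `\` range e in PN.
have sub0 (A B : set V) : A `<=` B -> P (Y @^-1` B) = 0%E -> P (Y @^-1` A) = 0%E.
  move=> AB PB; apply/eqP; rewrite eq_le measure_ge0 andbT -PB le_measure ?inE//.
  exact: preimage_subset.
(* If some initial segment of [N] is not null, [S0] is the one cut at the least such index;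
   otherwise [S0] is [N]. Either way the initial segments of [S0] are null while [S0] is not. *)
have [S0 [S0N PS0 S0lt]] : exists S0, [/\ S0 `<=` N, P (Y @^-1` S0) <> 0%E &
    forall v, S0 v -> P (Y @^-1` (S0 `&` [set u | lt u v])) = 0%E].
  have [|noA] := pselect ([set v | P (Y @^-1` (N `&` [set u | lt u v])) <> 0%E] !=set0).
    move=> /wf[v0 Pv0 v0min]; exists (N `&` [set u | lt u v0]); split=> // v [_ /v0min/contrapT].
    by apply: sub0 => u [[]].
  exists N; split=> // v _; apply: contrapT => H; apply: noA; by exists v.
have S0eq v : S0 v -> P (Y @^-1` (S0 `&` [set v])) = 0%E.
  move=> /S0N[_ /eP]; apply: sub0; exact: subIsetr.
pose C := \bigcup_(ij in [set ij : V * V | [/\ I ij.1, I ij.2 & lt ij.1 ij.2]])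
  [set f ij.1 + 4 *: f ij.2].
have cC : closed C.
  apply: (@closed_bigcup_separated _ _ _ _ _ 1) => //.
    move=> ij _; apply: accessible_closed_set1; apply: hausdorff_accessible.
    exact: norm_hausdorff.
  move=> [i j] [i' j'] _ _ [/= Ii Ij ij] [/= Ii' Ij' _] -> ->.
  by move=> /(sum_scaled_separated wolt sepf Ii Ij Ii' Ij' ij)[-> ->].
have CP i j : I i -> I j -> C (f i + 4 *: f j) <-> lt i j.
  move=> Ii Ij; split=> [[[i' j'] [/= Ii' Ij' ij'] E]|ij]; last by exists (i, j).
  have E1 : `|(f i' + 4 *: f j') - (f i + 4 *: f j)| < 1.
    by rewrite E subrr normr0.
  by have [<- <-] := sum_scaled_separated wolt sepf Ii' Ij' Ii Ij ij' E1.
pose E := [set z : T * T | [/\ S0 (Y z.1), S0 (Y z.2) & lt (Y z.1) (Y z.2)]].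
have mE : measurable E.
  have -> : E = (fst @^-1` (Y @^-1` S0)) `&` (snd @^-1` (Y @^-1` S0)) `&`
      ((fun z : T * T => f (Y z.1) + 4 *: f (Y z.2)) @^-1` C).
    apply/seteqP; split=> z.
      move=> [z1 z2 lz]; split=> //; apply/CP => //; first by have [] := S0N _ z1.
      by have [] := S0N _ z2.
    move=> [[z1 z2] Cz]; split => //; apply/CP => //; first by have [] := S0N _ z1.
    by have [] := S0N _ z2.
  have m1 (S : set V) : measurable ((fst : T * T -> T) @^-1` (Y @^-1` S)).
    by rewrite -[X in measurable X]setTI; exact: measurable_fst.
  have m2 (S : set V) : measurable ((snd : T * T -> T) @^-1` (Y @^-1` S)).
    by rewrite -[X in measurable X]setTI; exact: measurable_snd.
  apply: measurableI; first exact: measurableI.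
  apply: (borel_rvD mD (f := fun z : T * T => f (Y z.1)) (g := fun z => 4 *: f (Y z.2))).
  - by move=> A _; exact: (m1 (f @^-1` A)).
  - by move=> A _; exact: (m2 ((fun v => 4 *: f v) @^-1` A)).
  - exact: closed_borel_set.
have : (P \x P)%E E = (P \x^ P)%E E.
  apply: product_measure_unique => // A B mA mB.
  exact: product_measure2E.
(* Freezing the second coordinate leaves the outcomes whose index precedes a given element of [S0],
   a null set. *)
have -> : (P \x^ P)%E E = 0%E.
  apply: integral0_eq => w _ /=.
  have [Sw|nSw] := pselect (S0 (Y w)); last first.
    rewrite (_ : ysection E w = set0) ?measure0//.
    by apply/seteqP; split=> w' //=; rewrite /ysection /= inE => -[].
  rewrite (_ : ysection E w = Y @^-1` (S0 `&` [set u | lt u (Y w)])) ?S0lt//.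
  apply/seteqP; split=> w'; rewrite /ysection /= inE; first by case.
  by case.
(* Freezing the first coordinate leaves, by trichotomy, the whole event of [S0] up to an initial
   segment and a singleton, both null. *)
have -> : (P \x P)%E E = (P (Y @^-1` S0) * P (Y @^-1` S0))%E.
  transitivity (\int[P]_w (P (Y @^-1` S0) * (\1_(Y @^-1` S0) w)%:E))%E.
    apply: eq_integral => w _ /=; rewrite indicE.
    have [Sw|nSw] := pselect (S0 (Y w)); last first.
      rewrite memNset// mule0 (_ : xsection E w = set0) ?measure0//.
      by apply/seteqP; split=> w' //=; rewrite /xsection /= inE => -[].
    rewrite mem_set// mule1.
    rewrite (_ : Y @^-1` S0 = xsection E w `|`
        ((Y @^-1` (S0 `&` [set u | lt u (Y w)])) `|` (Y @^-1` (S0 `&` [set Y w])))).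
      have mx : measurable (xsection E w) by exact: measurable_xsection.
      rewrite measureU0 //; first exact: measurableU.
      by rewrite measureU0 //; [exact: S0lt|exact: S0eq].
    apply/seteqP; split=> w'.
      move=> Sw'; have [?|?|?] := tri (Y w') (Y w).
      - by right; left.
      - by right; right.
      - by left; rewrite /xsection /= inE.
    by move=> [|[[]//|[]//]]; rewrite /xsection /= inE => -[].
  rewrite ge0_integralZl//; last by apply/measurable_EFinP; exact: measurable_indic.
  by rewrite integral_indic// setIT.
by move=> /eqP; rewrite mule_eq0 => /orP[/eqP|/eqP].
Qed.

(** [I] keeps the vectors at positive distance from the span of all their predecessors, and [f]
    divides them by a lower bound [E v] of that distance. A discarded vector is a limit of
    combinations of predecessors, so well-founded induction makes the span of the [f v] dense. *)
Lemma separated_family_exists (R : realType) (V : normedModType R)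
    (lt : V -> V -> Prop) : strict_well_order lt ->
  exists I L (f : V -> V), separated_family lt I L f /\
    forall (v : V) (e : R), 0 < e -> exists s : seq (rat * V),
      (forall q, q \in s -> I q.2) /\
      `|v - \sum_(q <- s) ratr q.1 *: f q.2| < e.
Proof.
move=> [ltxx lttrans tri wf].
pose L v : set V := [set w | exists s : seq (R * V),
  (forall x, x \in s -> lt x.2 v) /\ w = \sum_(x <- s) x.1 *: x.2].
pose I : set V := [set v | exists2 e : R, 0 < e & forall w, L v w -> e <= `|v - w|].
have /choice[E EP] : forall v, exists e : R, I v ->
    0 < e /\ forall w, L v w -> e <= `|v - w|.
  move=> v; have [[e e0 le]|nI] := pselect (I v); first by exists e.
  by exists 0 => /nI.
pose f v := (E v)^-1 *: v.
have LD v x y : L v x -> L v y -> L v (x + y).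
  move=> [s [sv ->]] [t [tv ->]]; exists (s ++ t); rewrite big_cat; split=> // z.
  by rewrite mem_cat => /orP[/sv|/tv].
have LZ v c x : L v x -> L v (c *: x).
  move=> [s [sv ->]]; exists [seq (c * z.1, z.2) | z <- s]; split.
    by move=> _ /mapP[z /sv zv ->].
  by rewrite big_map scaler_sumr; apply: eq_bigr => z _; rewrite scalerA.
exists I, L, f; split.
  split=> //.
  - move=> u v Iu uv; apply: (LZ); exists [:: (1, u)]; rewrite big_seq1 scale1r.
    by split=> // x; rewrite inE => /eqP ->.
  - move=> v c x Iv Lx; have [E0 vE] := EP v Iv.
    have [->|c0] := eqVneq c 0; first by rewrite normr0.
    have -> : c *: f v + x = (c / E v) *: (v - (- (E v / c)) *: x).
      rewrite scalerBr scaleNr scalerN opprK scalerA /f scalerA; congr (_ + _).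
      by rewrite mulrA divfK ?gt_eqF// divff// scale1r.
    rewrite normrZ normrM normfV (gtr0_norm E0) -mulrA ler_peMr//.
    by rewrite ler_pdivlMl// mulr1; apply: vE; exact: LZ.
pose Sp : set V := [set w | exists s : seq (R * V),
  (forall x, x \in s -> I x.2) /\ w = \sum_(x <- s) x.1 *: f x.2].
pose Z : set V := [set v | forall e : R, 0 < e -> exists2 w, Sp w & `|v - w| < e].
have ZD x y : Z x -> Z y -> Z (x + y).
  move=> Zx Zy e e0; have e20 : 0 < e / 2 by lra.
  have [_ [s [sI ->]] xs] := Zx _ e20; have [_ [t [tI ->]] yt] := Zy _ e20.
  exists (\sum_(z <- s ++ t) z.1 *: f z.2).
    by exists (s ++ t); split => // z; rewrite mem_cat => /orP[/sI|/tI].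
  by rewrite big_cat opprD addrACA (le_lt_trans (ler_normD _ _))//; lra.
have ZZ c x : Z x -> Z (c *: x).
  move=> Zx e e0; have ec0 : 0 < e / (`|c| + 1) by rewrite divr_gt0// ltr_wpDl.
  have [_ [s [sI ->]] xs] := Zx _ ec0.
  exists (c *: \sum_(z <- s) z.1 *: f z.2).
    exists [seq (c * z.1, z.2) | z <- s]; split.
      by move=> _ /mapP[z /sI zI ->].
    by rewrite big_map scaler_sumr; apply: eq_bigr => z _; rewrite scalerA.
  rewrite -scalerBr normrZ; move: xs; rewrite ltr_pdivlMr ?ltr_wpDl// => H.
  apply: le_lt_trans H; rewrite mulrC ler_wpM2l// lerDl//.
have Z0 : Z 0.
  by move=> e e0; exists 0; [exists [::]; rewrite big_nil|rewrite subr0 normr0].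
have ZI v : I v -> Z v.
  move=> Iv e e0; exists v; last by rewrite subrr normr0.
  exists [:: (E v, v)]; rewrite big_seq1 /= /f scalerA divff ?scale1r; last first.
    by rewrite gt_eqF//; have [] := EP v Iv.
  by split=> // z; rewrite inE => /eqP ->.
have ZT v : Z v.
  apply: contrapT => nZ; have [|m nZm mmin] := wf (~` Z); first by exists v.
  apply: nZm; have [/ZI//|nIm] := pselect (I m).
  move=> e e0; apply: contrapT => H; apply: nIm; exists (e / 2); first by lra.
  move=> w [s [sm wE]]; rewrite leNgt; apply/negP => mw; apply: H.
  have Zw : Z w.
    rewrite {}wE {mw}; elim: s sm => [|z s IH] sm; first by rewrite big_nil.
    rewrite big_cons; apply: (ZD).
      by apply: (ZZ); apply: contrapT; apply: mmin; apply: sm; rewrite mem_head.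
    by apply: IH => z' z's; apply: sm; rewrite in_cons z's orbT.
  have [|w' Sw' ww'] := Zw (e / 2); first by lra.
  exists w' => //; rewrite (_ : m - w' = (m - w) + (w - w')); last by rewrite subrKA.
  by rewrite (le_lt_trans (ler_normD _ _))//; lra.
(* Rational coefficients are wanted so that, once the indices are confined to countable sets, the
   combinations are countable too. *)
have ratE (s : seq (R * V)) (e : R) : 0 < e -> (forall x, x \in s -> I x.2) ->
    exists t : seq (rat * V), (forall q, q \in t -> I q.2) /\
    `|\sum_(x <- s) x.1 *: f x.2 - \sum_(q <- t) ratr q.1 *: f q.2| < e.
  elim: s e => [|z s IH] e e0 sI; first by exists [::]; rewrite !big_nil subrr normr0.
  have [||t [tI st]] := IH (e / 2); first by lra.
    by move=> x xs; apply: sI; rewrite in_cons xs orbT.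
  have ef0 : 0 < e / 2 / (`|f z.2| + 1) by rewrite !divr_gt0// ltr_wpDl.
  have /rat_in_itvoo[q] : z.1 < z.1 + e / 2 / (`|f z.2| + 1) by rewrite ltrDl.
  rewrite in_itv /= => /andP[q1 q2].
  exists ((q, z.2) :: t); split.
    by move=> x; rewrite inE => /predU1P[->|/tI//]; apply: sI; rewrite mem_head.
  rewrite !big_cons /= opprD addrACA (le_lt_trans (ler_normD _ _))//.
  rewrite [ltRHS](splitr e) ltrD//.
  rewrite -scalerBl normrZ ltr0_norm ?subr_lt0// opprB.
  have : (ratr q - z.1) * (`|f z.2| + 1) < e / 2 by rewrite -ltr_pdivlMr ?ltr_wpDl// ltrBlDl.
  apply: le_lt_trans; rewrite ler_wpM2l ?subr_ge0 ?ltW// ltrDl //.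
move=> v e e0; have e20 : 0 < e / 2 by lra.
have [_ [s [sI ->]] vs] := ZT v _ e20; have [t [tI st]] := ratE s _ e20 sI.
exists t; split=> //; rewrite -(subrKA (\sum_(x <- s) x.1 *: f x.2)).
by rewrite (le_lt_trans (ler_normD _ _))//; lra.
Qed.

(** [X] is rounded to the first vector, in the well-order, closer than [e / 2], and that vector is
    replaced by a rational combination within [e / 2]. All preimages under the rounding are Borel,
    so [separated_family_countable] applies to each index occurring in the combination. *)
Lemma borel_rv_eventually_near_countable (R : realType) (V : normedModType R) d
    (T : measurableType d) (P : probability T R) (X : T -> V) (e : R) :
  measurable_addition V -> borel_rv X -> 0 < e ->
  exists y : nat -> V, P (\bigcup_n (X @^-1` ball (y n) e)) = 1%E.
Proof.
move=> mD bX e0.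
have [lt wolt] := strict_well_order_exists V.
have [I [L [f [sepf dense]]]] := separated_family_exists wolt.
have [ltxx lttrans tri wf] := wolt.
have e20 : 0 < e / 2 by lra.
have /choice[r rP] : forall x, exists v : V,
    `|x - v| < e / 2 /\ forall u, lt u v -> e / 2 <= `|x - u|.
  move=> x; have [|v xv vmin] := wf [set v | `|x - v| < e / 2].
    by exists x; rewrite /= subrr normr0.
  by exists v; split=> // u /vmin /negP; rewrite -leNgt.
have bdist v : continuous (fun x : V => `|x - v|).
  by move=> x; apply: cvg_norm; apply: cvgB; [exact: cvg_id|exact: cvg_cst].
have br (S : set V) : borel_set (r @^-1` S).
  (* The margin [n.+1%:R^-1] separates the cells of distinct [v] by that amount, so any union of
     them over [v] is closed. *)
  pose Z n v := [set x : V | `|x - v| <= e / 2 - n.+1%:R^-1 /\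
    forall u, lt u v -> e / 2 <= `|x - u|].
  have -> : r @^-1` S = \bigcup_n \bigcup_(v in S) Z n v.
    apply/seteqP; split=> x.
      move=> Sx; have [xr rmin] := rP x.
      have d0 : 0 < e / 2 - `|x - r x| by rewrite subr_gt0.
      exists (Num.truncn (e / 2 - `|x - r x|)^-1) => //; exists (r x) => //.
      split=> //; rewrite lerBrDr -lerBrDl invf_ple ?posrE//.
      by apply/ltW; exact: truncnS_gt.
    move=> [n _ [v Sv [xv vmin]]]; have [xr rmin] := rP x.
    have xv' : `|x - v| < e / 2 by rewrite (le_lt_trans xv)// gtrBl invr_gt0.
    have [/vmin|rv|/rmin] := tri (r x) v; [|by rewrite /= rv|].
      by rewrite leNgt xr.
    by rewrite leNgt xv'.
  apply: borel_set_bigcup => n; apply: closed_borel_set.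
  apply: (@closed_bigcup_separated _ _ _ _ _ n.+1%:R^-1); first by rewrite invr_gt0.
    move=> v _; rewrite (_ : Z n v = [set x | `|x - v| <= e / 2 - n.+1%:R^-1] `&`
        \bigcap_(u in [set u | lt u v]) [set x | e / 2 <= `|x - u|]); last first.
      by apply/seteqP; split=> x [xv H]; split=> // u; exact: H.
    apply: closedI.
      apply: (@closed_comp _ _ (fun x : V => `|x - v|) [set y | y <= e / 2 - n.+1%:R^-1]).
        by move=> x _; exact: bdist.
      exact: closed_le.
    apply: closed_bigI => u _.
    apply: (@closed_comp _ _ (fun x : V => `|x - u|) [set y | e / 2 <= y]).
      by move=> x _; exact: bdist.
    exact: closed_ge.
  have half u v x y : lt u v -> Z n u x -> Z n v y -> `|x - y| < n.+1%:R^-1 -> False.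
    move=> uv [xu _] [_ /(_ _ uv) yu] xy.
    rewrite distrC in xy; have := le_lt_trans (ler_distD x y u) (ltr_leD xy xu).
    by rewrite [ltRHS]addrC subrK ltNge yu.
  move=> u v x y _ _ Zx Zy xy; have [uv|//|vu] := tri u v; exfalso.
    exact: half uv Zx Zy xy.
  by apply: half vu Zy Zx _; rewrite distrC.
have /choice[app appP] : forall v : V, exists s : seq (rat * V),
    (forall q, q \in s -> I q.2) /\
    `|v - \sum_(q <- s) ratr q.1 *: f q.2| < e / 2.
  by move=> v; exact: dense.
pose Y k w := (nth (0, 0) (app (r (X w))) k).2.
have mY k (S : set V) : measurable (Y k @^-1` S).
  exact: bX (br [set v | S (nth (0, 0) (app v) k).2]).
have /choice[g gP] k : exists g : nat -> V, P (Y k @^-1` (I `\` range g)) = 0%E.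
  exact: separated_family_countable mD wolt sepf (mY k).
(* A code lists, for each term, its coefficient, its position [k] and the rank of its index in the
   enumeration [g k]; such lists are countable. *)
pose dec (t : seq (rat * (nat * nat))) :=
  \sum_(q <- [seq (z.1, g z.2.1 z.2.2) | z <- t]) ratr q.1 *: f q.2.
exists (fun n => if unpickle n is Some t then dec t else 0).
set A := \bigcup_n _.
have mA : measurable A.
  apply: bigcupT_measurable => n; apply: bX; apply: open_borel_set; exact: ball_open.
suff A0 : P (~` A) = 0%E.
  by rewrite -[A]setCK probability_setC ?A0 ?sube0//; exact: measurableC.
have : P.-negligible (\bigcup_k (Y k @^-1` (I `\` range (g k)))).
  by apply: negligible_bigcup => k; apply/negligibleP => //; exact: gP.
move=> Yneg; apply/negligibleP; first exact: measurableC.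
apply: negligibleS Yneg => w nAw; apply: contrapT => nY; apply: nAw.
have /choice[h hP] k : exists i, (k < size (app (r (X w))))%N -> g k i = Y k w.
  have [ks|_] := ltnP k (size (app (r (X w)))); last by exists 0%N.
  have [[i _ gi]|ng] := pselect (range (g k) (Y k w)); first by exists i.
  exfalso; apply: nY; exists k => //; split=> //.
  by apply: (appP _).1; exact: mem_nth.
pose t := [seq ((nth (0, 0) (app (r (X w))) k).1, (k, h k)) | k <- iota 0 (size (app (r (X w))))].
exists (pickle t) => //; rewrite pickleK /= -ball_normE /= distrC.
have -> : dec t = \sum_(q <- app (r (X w))) ratr q.1 *: f q.2.
  rewrite /dec; congr (\sum_(q <- _) _).
  rewrite -[RHS](mkseq_nth (0, 0)) /mkseq /t -map_comp.
  apply/eq_in_map => k; rewrite mem_iota add0n /= => ks.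
  by rewrite hP// /Y -surjective_pairing.
have := ler_distD (r (X w)) (X w) (\sum_(q <- app (r (X w))) ratr q.1 *: f q.2).
by have [_] := appP (r (X w)); have [+ _] := rP (X w); lra.
Qed.

(** * Finite random walks *)

Section walk.
Context {R : realType} {V : normedModType R}.
Implicit Types (p : nat -> R) (y : nat -> V) (m n : nat) (f g : V -> R).

(* [walk p y m n f v] integrates [f] against the law of [v] plus [n] independent
   steps, each distributed as the measure [\sum_(k < m) p k * delta_(y k)]. *)
Definition walk p y m n f : V -> R :=
  iter n (fun g v => \sum_(k < m) p k * g (v + y k)) f.

Definition point_indic (v : V) : V -> R := fun u => (u == v)%:R.

Lemma walkS p y m n f v :
  walk p y m n.+1 f v = \sum_(k < m) p k * walk p y m n f (v + y k).
Proof. by []. Qed.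

Lemma walkD p y m n n' f :
  walk p y m (n + n') f = walk p y m n (walk p y m n' f).
Proof. exact: iterD. Qed.

Lemma walk_shift p y m n f u v :
  walk p y m n f (u + v) = walk p y m n (fun x => f (x + v)) u.
Proof.
elim: n u => // n IH u; rewrite !walkS; apply: eq_bigr => k _.
by rewrite addrAC IH.
Qed.

Lemma walkZ p y m n c f v :
  walk p y m n (fun x => c * f x) v = c * walk p y m n f v.
Proof.
elim: n v => // n IH v; rewrite !walkS mulr_sumr; apply: eq_bigr => k _.
by rewrite IH mulrCA.
Qed.

Lemma walk_sum p y m n (I : Type) (s : seq I) (F : I -> V -> R) v :
  walk p y m n (fun x => \sum_(i <- s) F i x) v =
  \sum_(i <- s) walk p y m n (F i) v.
Proof.
elim: n v => // n IH v; rewrite walkS exchange_big; apply: eq_bigr => k _ /=.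
by rewrite IH mulr_sumr.
Qed.

Lemma walk_ge0 p y m n f v : (forall k, 0 <= p k) -> (forall u, 0 <= f u) ->
  0 <= walk p y m n f v.
Proof.
move=> p0 f0; elim: n v => // n IH v; rewrite walkS.
by apply: sumr_ge0 => k _; rewrite mulr_ge0.
Qed.

Lemma le_walk p y m n f g v : (forall k, 0 <= p k) -> (forall u, f u <= g u) ->
  walk p y m n f v <= walk p y m n g v.
Proof.
move=> p0 fg; elim: n v => // n IH v; rewrite !walkS.
by apply: ler_sum => k _; rewrite ler_wpM2l.
Qed.

(** The order of the steps does not affect the position, which is determined by the number [c k] of
    uses of each step; the bound [c k <= n] suffices for the counting in [walk_le_card]. *)
Lemma le_walk_support p y m n f g v : (forall k, 0 <= p k) ->
  (forall c : nat -> nat, (forall k, (c k <= n)%N) ->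
    f (v + \sum_(k < m) y k *+ c k) <= g (v + \sum_(k < m) y k *+ c k)) ->
  walk p y m n f v <= walk p y m n g v.
Proof.
move=> p0; elim: n v => [|n IH] v fg.
  have := fg (fun=> 0%N) (fun=> leqnn 0).
  by under eq_bigr do rewrite mulr0n; rewrite big1_eq addr0.
rewrite !walkS; apply: ler_sum => k _; rewrite ler_wpM2l//.
apply: IH => c cn.
have -> : v + y k + \sum_(i < m) y i *+ c i =
    v + \sum_(i < m) y i *+ (c i + (i == k :> nat)).
  rewrite -addrA; congr (_ + _); rewrite (bigD1 k)//= [RHS](bigD1 k)//= eqxx addrA.
  rewrite mulrnDr mulr1n [y k + _]addrC; congr (_ + _).
  by apply: eq_bigr => i ik; rewrite (negbTE (ik : i != k :> nat)) addn0.
apply: (fg (fun i => c i + (i == k))%N) => i; rewrite -addn1 leq_add//.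
by case: eqP.
Qed.

Lemma le_walk_steps p y m m' n f v : (forall k, 0 <= p k) ->
  (forall u, 0 <= f u) -> (m <= m')%N ->
  walk p y m n f v <= walk p y m' n f v.
Proof.
move=> p0 f0 mm'; elim: n v => // n IH v; rewrite !walkS.
pose F m0 k := p k * walk p y m0 n f (v + y k).
rewrite -(big_mkord xpredT (F m)) -(big_mkord xpredT (F m')).
rewrite (big_cat_nat (leq0n m) mm') /= -[leLHS]addr0 lerD//.
  by apply: ler_sum => k _; rewrite ler_wpM2l.
by apply: sumr_ge0 => k _; rewrite mulr_ge0 ?walk_ge0.
Qed.

(** The right-hand side is cut at time [n], keeping only the paths that are at [v] then. *)
Lemma walk_indic_mul_le p y m n n' f v : (forall k, 0 <= p k) ->
  (forall u, 0 <= f u) ->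
  walk p y m n (point_indic v) 0 * walk p y m n' f v <= walk p y m (n + n') f 0.
Proof.
move=> p0 f0; rewrite walkD mulrC -walkZ; apply: le_walk => // u.
rewrite /point_indic; have [->|_] := eqVneq u v; first by rewrite mulr1.
by rewrite mulr0 walk_ge0.
Qed.

Lemma walk_indicD_ge p y m n n' v v' : (forall k, 0 <= p k) ->
  walk p y m n (point_indic v) 0 * walk p y m n' (point_indic v') 0 <=
  walk p y m (n + n') (point_indic (v + v')) 0.
Proof.
move=> p0; have pi0 u : 0 <= point_indic (v + v') u by exact: ler0n.
apply: le_trans (walk_indic_mul_le y m n n' v p0 pi0).
have -> // : walk p y m n' (point_indic v') 0 = walk p y m n' (point_indic (v + v')) v.
have := walk_shift p y m n' (point_indic (v + v')) 0 v; rewrite add0r => ->.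
congr (walk _ _ _ _ _ _).
by apply/funext => u; rewrite /point_indic [u + v]addrC (inj_eq (addrI v)).
Qed.

Lemma walk_expR p y m n (l : V -> R) v : (forall u v, l (u + v) = l u + l v) ->
  walk p y m n (fun u => expR (l u)) v =
  (\sum_(k < m) p k * expR (l (y k))) ^+ n * expR (l v).
Proof.
move=> lD; elim: n v => [|n IH] v; first by rewrite expr0 mul1r.
rewrite walkS exprS -mulrA mulr_suml; apply: eq_bigr => k _.
by rewrite IH lD expRD; ring.
Qed.

(** The function is replaced by its values at the sums [S c], at most [n.+1 ^ m] of them. Distinct
    [c] may give the same sum; counting it twice only increases the bound. *)
Lemma walk_le_card p y m n f B : (forall k, 0 <= p k) -> (forall u, 0 <= f u) ->
  (forall v, f v * walk p y m n (point_indic v) 0 <= B) ->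
  walk p y m n f 0 <= (n.+1 ^ m)%:R * B.
Proof.
move=> p0 f0 fB.
pose S (c : {ffun 'I_m -> 'I_n.+1}) := \sum_(k < m) y k *+ c k.
apply: (@le_trans _ _ (walk p y m n
    (fun u => \sum_(c <- enum {ffun 'I_m -> 'I_n.+1}) f (S c) * point_indic (S c) u) 0)).
  apply: le_walk_support => // c cn; rewrite add0r.
  pose c' : {ffun 'I_m -> 'I_n.+1} := [ffun k : 'I_m => inord (c k)].
  have -> : \sum_(k < m) y k *+ c k = S c'.
    by apply: eq_bigr => k _; rewrite ffunE inordK// ltnS.
  rewrite (big_rem c') ?mem_enum//= /point_indic eqxx mulr1 lerDl.
  by apply: sumr_ge0 => i _; rewrite mulr_ge0.
rewrite walk_sum; under eq_bigr do rewrite walkZ.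
rewrite big_enum /=; apply: (@le_trans _ _ (\sum_(c : {ffun 'I_m -> 'I_n.+1}) B)).
  by apply: ler_sum => c _; exact: fB.
by rewrite sumr_const card_ffun !card_ord mulr_natl.
Qed.

End walk.

(** * From bounds on point masses to a functional *)

Lemma le_of_expr_le_poly (R : realType) (a b : R) m : 0 <= a -> 0 < b ->
  (forall n, a ^+ n <= (n.+1 ^ m)%:R * b ^+ n) -> a <= b.
Proof.
move=> a0 b0 H; rewrite leNgt; apply/negP => ba.
have x1 : 1 < a / b by rewrite ltr_pdivlMr// mul1r.
have x0 : 0 < a / b by apply: lt_trans x1.
(* Splitting the exponent into [m.+1] parts instead of [m] leaves one spare factor [n.+1%:R], which
   the polynomial cannot absorb. Below, [h] is the constant with [h * n.+1%:R <= 1 + n%:R * L <=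
   expR (n%:R * L)]. *)
pose L := ln (a / b) / m.+1%:R.
have L0 : 0 < L by rewrite divr_gt0// ln_gt0.
pose h := Num.min 1 L.
have h0 : 0 < h by rewrite /h lt_min ltr01.
have key n : n.+1%:R <= (h ^+ m.+1)^-1.
  have : (h * n.+1%:R) ^+ m.+1 <= (n.+1 ^ m)%:R.
    apply: (@le_trans _ _ ((a / b) ^+ n)); last first.
      by rewrite expr_div_n ler_pdivrMr ?exprn_gt0.
    have -> : (a / b) ^+ n = expR (n%:R * L) ^+ m.+1.
      rewrite -expRM_natl /L -[in LHS](lnK (x0 : a / b \is Num.pos)) -expRM_natl; congr expR.
      by rewrite [RHS]mulrCA [m.+1%:R * _]mulrC divfK ?pnatr_eq0.
    rewrite lerXn2r ?nnegrE ?expR_ge0 ?mulr_ge0 ?(ltW h0)//.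
    apply: le_trans (expR_ge1Dx _); rewrite -natr1 mulrDr mulr1 addrC lerD//.
      by rewrite /h ge_min lexx.
    by rewrite mulrC ler_wpM2l// /h ge_min lexx orbT.
  rewrite exprMn natrX [n.+1%:R ^+ m.+1]exprS mulrA -ler_pdivlMr ?exprn_gt0//.
  by rewrite divff ?expf_neq0 ?pnatr_eq0// -ler_pdivlMl ?exprn_gt0// mulr1.
have := key (Num.truncn (h ^+ m.+1)^-1).
by rewrite leNgt truncnS_gt.
Qed.

(* The exponential moment of the n-step sums is a sum over at most [n.+1 ^ m]
   values, so that bounding each term is enough. *)
Lemma walk_exponential_functional (R : realType) (V : normedModType R)
    (p : nat -> R) (y : nat -> V) (M c : R) : 0 <= M -> (forall k, 0 <= p k) ->
  (forall m n v, walk p y m n (point_indic v) 0 <= expR (c * n%:R + M * `|v|)) ->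
  exists l : V -> R, [/\ forall a u v, l (a *: u + v) = a * l u + l v,
    forall v, `|l v| <= M * `|v| &
    forall m, \sum_(k < m) p k * expR (l (y k)) <= expR c].
Proof.
move=> M0 p0 H.
pose w m n v := walk p y m n (point_indic v) 0.
(* A pair [(v, h)] encodes the constraint [l v <= h]. Letting [m] and [n] vary makes this set
   additively closed: lengths add up, [maxn] merges the alphabets, and masses are
   supermultiplicative. *)
pose G : set (V * R) := [set x | exists m n,
  0 < w m n x.1 /\ c * n%:R - ln (w m n x.1) <= x.2].
have [|x x'|x|l [ll lM lG]] := @submonoid_dominating_functional R V G M M0.
- by exists 0%N, 0%N; rewrite /w /walk /= /point_indic eqxx ln1 mulr0 subr0.
- move=> [m [n [w0 wx]]] [m' [n' [w0' wx']]].
  exists (maxn m m'), (n + n')%N.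
  have ww : w m n x.1 * w m' n' x'.1 <= w (maxn m m') (n + n')%N (x.1 + x'.1).
    apply: le_trans (walk_indicD_ge _ _ _ _ _ _ p0); apply: ler_pM; [exact: ltW|exact: ltW| |].
      by apply: le_walk_steps; rewrite ?leq_maxl// => u; rewrite /point_indic ler0n.
    by apply: le_walk_steps; rewrite ?leq_maxr// => u; rewrite /point_indic ler0n.
  have w1 : 0 < w (maxn m m') (n + n')%N (x.1 + x'.1).
    by apply: lt_le_trans ww; rewrite mulr_gt0.
  split=> //=; apply: le_trans (lerD wx wx').
  rewrite natrD mulrDr addrACA lerD2l -opprD lerN2 -lnM ?posrE//.
  by rewrite ler_ln// posrE mulr_gt0.
- move=> [m [n [w0 /(le_trans _) wx]]].
  have := H m n x.1; rewrite -[X in X <= _](lnK w0) ler_expR => Hx.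
  by rewrite -lerBlDl sub0r; apply: wx; rewrite lerBrDr -lerBrDl opprK addrC; lra.
exists l; split=> // m.
have lD u v : l (u + v) = l u + l v by rewrite -[u]scale1r ll mul1r scale1r.
have sum0 : 0 <= \sum_(k < m) p k * expR (l (y k)).
  by apply: sumr_ge0 => k _; rewrite mulr_ge0 ?expR_ge0.
apply: (@le_of_expr_le_poly _ _ _ m sum0 (expR_gt0 _)) => n.
have -> : (\sum_(k < m) p k * expR (l (y k))) ^+ n =
    walk p y m n (fun u => expR (l u)) 0.
  by rewrite walk_expR// (_ : l 0 = 0) ?expR0 ?mulr1//; have := lD 0 0; rewrite addr0; lra.
apply: walk_le_card => // v.
have [w0|w0] := ltP 0 (w m n v); last first.
  by rewrite (le_trans (mulr_ge0_le0 (expR_ge0 _) w0))// exprn_ge0// expR_ge0.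
have /lG /= : G (v, c * n%:R - ln (w m n v)) by exists m, n.
rewrite -/(w m n v) -[X in expR _ * X](lnK w0) -expRD -expRM_natl ler_expR mulrC.
by lra.
Qed.

(** * Comparison of empirical means with walks *)

(** Downward induction on words: [h s] stands for the mass of an event below the prefix [s],
    splitting by the next letter reproduces the recursion of [walk], and only the leaves need a
    comparison. *)
Lemma walk_le_tree (R : realType) (V : normedModType R) (p : nat -> R)
    (y : nat -> V) (h : seq nat -> R) m n (f : V -> R) :
  (forall s : seq nat, (size s < n)%N -> \sum_(k < m) h (rcons s k) <= h s) ->
  (forall s, size s = n -> all (fun k => k < m)%N s ->
    \prod_(k <- s) p k * f (\sum_(k <- s) y k) <= h s) ->
  walk p y m n f 0 <= h [::].
Proof.
move=> hsum leaf.
suff H l s : (size s + l = n)%N -> all (fun k => k < m)%N s ->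
    \prod_(k <- s) p k * walk p y m l f (\sum_(k <- s) y k) <= h s.
  by have := H n [::] (add0n n) isT; rewrite !big_nil mul1r.
elim: l s => [|l IH] s; first by rewrite addn0; exact: leaf.
rewrite addnS => sl sm; rewrite walkS mulr_sumr (le_trans _ (hsum s _))//; last first.
  by rewrite -sl ltnS leq_addr.
apply: ler_sum => k _; have := IH (rcons s k).
rewrite size_rcons addSn sl all_rcons ltn_ord sm => /(_ erefl isT).
by rewrite !big_rcons /= mulrA.
Qed.

Lemma tree_le_walk (R : realType) (V : normedModType R) (p : nat -> R)
    (y : nat -> V) (h : seq nat -> R) m n (f : V -> R) :
  (forall s : seq nat, (size s < n)%N -> h s <= \sum_(k < m) h (rcons s k)) ->
  (forall s, size s = n -> all (fun k => k < m)%N s ->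
    h s <= \prod_(k <- s) p k * f (\sum_(k <- s) y k)) ->
  h [::] <= walk p y m n f 0.
Proof.
move=> hsum leaf.
suff H l s : (size s + l = n)%N -> all (fun k => k < m)%N s ->
    h s <= \prod_(k <- s) p k * walk p y m l f (\sum_(k <- s) y k).
  by have := H n [::] (add0n n) isT; rewrite !big_nil mul1r.
elim: l s => [|l IH] s; first by rewrite addn0; exact: leaf.
rewrite addnS => sl sm; rewrite walkS mulr_sumr (le_trans (hsum s _))//.
  by rewrite -sl ltnS leq_addr.
apply: ler_sum => k _; have := IH (rcons s k).
rewrite size_rcons addSn sl all_rcons ltn_ord sm => /(_ erefl isT).
by rewrite !big_rcons /= mulrA.
Qed.

Section words.
Context {R : realType} {V : normedModType R} {d : measure_display}
  {T : measurableType d} {P : probability T R}.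
Implicit Types (X : nat -> T -> V) (A : nat -> set V) (G : set T) (s : seq nat).

(** The intersection ranges over [iota] so that [mutually_independent] applies as it stands. *)
Definition word_event X A s : set T :=
  \bigcap_(i in [set` iota 0 (size s)]) (X i @^-1` A (nth 0%N s i)).

Lemma word_eventP X A s w :
  word_event X A s w <-> forall i, (i < size s)%N -> A (nth 0%N s i) (X i w).
Proof.
split=> [Ew i si|Ew i]; first by apply: Ew; rewrite /= mem_iota.
by rewrite /= mem_iota => si; exact: Ew.
Qed.

Lemma word_event_rcons X A s k w : word_event X A (rcons s k) w <->
  word_event X A s w /\ A k (X (size s) w).
Proof.
rewrite !word_eventP size_rcons; split=> [H|[H Ak] i].
  split=> [i si|]; first by have := H i (ltnW si); rewrite nth_rcons si.
  by have := H (size s) (ltnSn _); rewrite nth_rcons ltnn eqxx.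
rewrite ltnS leq_eqVlt nth_rcons => /predU1P[->|si]; first by rewrite ltnn eqxx.
by rewrite si; exact: H.
Qed.

Lemma measurable_word_event X A s : (forall i, borel_rv (X i)) ->
  (forall k, borel_set (A k)) -> measurable (word_event X A s).
Proof.
by move=> bX bA; apply: bigcap_measurableType => i _; exact: bX.
Qed.

Lemma probability_word_event X A s : (forall i, borel_rv (X i)) -> mutually_independent P X ->
  identically_distributed P X -> (forall k, borel_set (A k)) ->
  P (word_event X A s) = (\prod_(k <- s) fine (P (X 0%N @^-1` A k)))%:E.
Proof.
move=> bX indX idX bA; rewrite /word_event indX ?iota_uniq//.
rewrite -[s in RHS](mkseq_nth 0%N) /mkseq big_map -prodEFin.
by apply: eq_bigr => i _; rewrite idX// fineK// fin_num_measure//; exact: bX.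
Qed.

(** [D] confines the first [n] variables to the first [m] cells, so the cell of the next variable
    partitions the event; disjointness of the cells makes the sum exact. *)
Lemma probability_word_event_rcons X A G m n s : (forall i, borel_rv (X i)) ->
  (forall k, borel_set (A k)) -> trivIset setT A -> measurable G ->
  (size s < n)%N ->
  let D := G `&` \bigcap_(i in [set` iota 0 n])
    (X i @^-1` \big[setU/set0]_(k < m) A k) in
  fine (P (word_event X A s `&` D)) =
  \sum_(k < m) fine (P (word_event X A (rcons s k) `&` D)).
Proof.
move=> bX bA tA mG sn D.
have bU := borel_set_bigsetU m bA.
have mD : measurable D.
  by apply: measurableI => //; apply: bigcap_measurableType => i _; exact: bX.
have mE t : measurable (word_event X A t `&` D).
  by apply: measurableI => //; exact: measurable_word_event.
rewrite (_ : word_event X A s `&` D =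
    \big[setU/set0]_(k < m) (word_event X A (rcons s k) `&` D)).
  rewrite (measure_bigsetU P (F := fun k => word_event X A (rcons s k) `&` D))//.
    by rewrite sum_fine// => k _; exact: fin_num_measure.
  move=> i j _ _ [w [[/word_event_rcons[_ Ai] _] [/word_event_rcons[_ Aj] _]]].
  by apply: tA => //; exists (X (size s) w).
rewrite -(bigcup_mkord _ (fun k => word_event X A (rcons s k) `&` D)).
apply/seteqP; split=> w; last first.
  by move=> [k _ [/word_event_rcons[Ew _] Dw]].
move=> [Ew Dw]; have : (\big[setU/set0]_(k < m) A k) (X (size s) w).
  by apply: Dw.2; rewrite /= mem_iota.
rewrite -(bigcup_mkord _ A) => -[k km Ak]; exists k => //; split=> //.
exact/word_event_rcons.
Qed.

End words.

Lemma ball_emp_mean (R : realType) (V : normedModType R) d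
    (T : measurableType d) (X : nat -> T -> V) n x (r : R) w :
  ball x r (emp_mean X n.+1 w) <->
  `|\sum_(i < n.+1) X i w - n.+1%:R *: x| < n.+1%:R * r.
Proof.
rewrite -ball_normE /= /emp_mean.
have -> : \sum_(i < n.+1) X i w - n.+1%:R *: x =
    - (n.+1%:R *: (x - n.+1%:R^-1 *: \sum_(i < n.+1) X i w)).
  by rewrite scalerBr scalerA divff ?pnatr_eq0// scale1r opprB.
by rewrite normrN normrZ normr_nat ltr_pM2l.
Qed.

Section comparison.
Context {R : realType} {V : normedModType R} {d : measure_display}
  {T : measurableType d} {P : probability T R}.
Implicit Types (X : nat -> T -> V) (A : nat -> set V) (y : nat -> V).

Lemma word_event_sum_near X A y (e : R) x s w :
  (forall k v, A k v -> `|v - y k| < e) -> word_event X A s w ->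
  `|(\sum_(i < size s) X i w - (size s)%:R *: x) - \sum_(k <- s) (y k - x)|
    <= (size s)%:R * e.
Proof.
move=> Ay /word_eventP Ew.
have -> : \sum_(i < size s) X i w - (size s)%:R *: x - \sum_(k <- s) (y k - x) =
    \sum_(i < size s) (X i w - y (nth 0%N s i)).
  rewrite (big_nth 0%N) big_mkord !sumrB sumr_const card_ord scaler_nat.
  by rewrite opprB addrA subrK.
apply: (le_trans (ler_norm_sum _ _ _)).
apply: (@le_trans _ _ (\sum_(i < size s) e)).
  by apply: ler_sum => i _; apply/ltW/Ay/Ew.
by rewrite sumr_const card_ord mulr_natl.
Qed.

(** Rounding [n.+1] variables to the centres of their cells moves the sum by at most [n.+1%:R * e],
    which the smaller radius [r - e] absorbs; each step is centred by subtracting [x]. *)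
Lemma emp_mean_ball_ge_walk X A y (e r : R) x m n :
  measurable_addition V -> (forall i, borel_rv (X i)) ->
  mutually_independent P X -> identically_distributed P X ->
  (forall k, borel_set (A k)) -> trivIset setT A ->
  (forall k v, A k v -> `|v - y k| < e) ->
  walk (fun k => fine (P (X 0%N @^-1` A k))) (fun k => y k - x) m n.+1
    (fun v => (`|v| < n.+1%:R * (r - e))%R%:R) 0 <=
  fine (P (emp_mean X n.+1 @^-1` ball x r)).
Proof.
move=> mD bX indX idX bA tA Ay.
have mG : measurable (emp_mean X n.+1 @^-1` ball x r).
  by apply: borel_rv_emp_mean => //; apply: open_borel_set; exact: ball_open.
have mE s : measurable (word_event X A s) by exact: measurable_word_event.
pose D := emp_mean X n.+1 @^-1` ball x r `&` \bigcap_(i in [set` iota 0 n.+1])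
    (X i @^-1` \big[setU/set0]_(k < m) A k).
have mDD : measurable D.
  apply: measurableI => //; apply: bigcap_measurableType => i _.
  by apply: bX; exact: borel_set_bigsetU.
apply: (@le_trans _ _ (fine (P (word_event X A [::] `&` D)))); last first.
  rewrite fine_le ?fin_num_measure// ?le_measure ?inE//; first exact: measurableI.
    exact: measurableI.
  by move=> w [_ []].
apply: (@walk_le_tree _ _ _ _ (fun s => fine (P (word_event X A s `&` D)))).
  by move=> s sn; rewrite (probability_word_event_rcons _ bX bA tA mG sn).
move=> s sn sm; case: ltP => [H|_]; last first.
  by rewrite mulr0 fine_ge0.
rewrite mulr1 (_ : _ `&` D = word_event X A s); last first.
  apply: setIidl => w Ew; split.
    apply/ball_emp_mean; have := word_event_sum_near x Ay Ew; rewrite sn.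
    move: (_ - _ *: x) (\sum_(k <- s) _) H => a b bH ab.
    rewrite -(subrK b a) (le_lt_trans (ler_normD _ _))//.
    by rewrite mulrBr in bH; lra.
  move=> i; rewrite mksetE mem_iota -sn => /andP[_ si]; rewrite -bigcup_mkord.
  exists (nth 0%N s i); last by move/word_eventP: Ew; apply.
  by apply: (allP sm); exact: mem_nth.
by rewrite (probability_word_event s bX indX idX bA).
Qed.

(** The radius grows by [e] for rounding, and the last term is the union bound for some variable
    leaving the first [m] cells. *)
Lemma emp_mean_ball_le_walk X A y (e r : R) x m n :
  measurable_addition V -> (forall i, borel_rv (X i)) ->
  mutually_independent P X -> identically_distributed P X ->
  (forall k, borel_set (A k)) -> trivIset setT A ->
  (forall k v, A k v -> `|v - y k| < e) ->
  fine (P (emp_mean X n.+1 @^-1` ball x r)) <=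
  walk (fun k => fine (P (X 0%N @^-1` A k))) (fun k => y k - x) m n.+1
    (fun v => (`|v| < n.+1%:R * (r + e))%R%:R) 0 +
  n.+1%:R * fine (P (X 0%N @^-1` ~` \big[setU/set0]_(k < m) A k)).
Proof.
move=> mD bX indX idX bA tA Ay.
set G := emp_mean X n.+1 @^-1` ball x r; set U := \big[setU/set0]_(k < m) A k.
have mG : measurable G.
  by apply: borel_rv_emp_mean => //; apply: open_borel_set; exact: ball_open.
have mE s : measurable (word_event X A s) by exact: measurable_word_event.
have bU : borel_set U by exact: borel_set_bigsetU.
pose D := G `&` \bigcap_(i in [set` iota 0 n.+1]) (X i @^-1` U).
have mDD : measurable D.
  by apply: measurableI => //; apply: bigcap_measurableType => i _; exact: bX.
have mC i : measurable (X i @^-1` ~` U) by apply: bX; exact: borel_setC.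
have PG : (P G <= P (word_event X A [::] `&` D) +
    n.+1%:R%:E * P (X 0%N @^-1` ~` U))%E.
  apply: (@le_trans _ _ (P ((word_event X A [::] `&` D) `|`
      \big[setU/set0]_(i < n.+1) (X i @^-1` ~` U)))).
    rewrite le_measure ?inE//.
      by apply: measurableU; [exact: measurableI|exact: bigsetU_measurable].
    move=> w Gw; have [H|] := pselect (forall i, (i < n.+1)%N -> U (X i w)).
      left; split; first exact/word_eventP.
      by split=> // i; rewrite mksetE mem_iota => /andP[_]; exact: H.
    move=> /existsNP[i /not_implyP[ni nU]]; right.
    by rewrite -(bigcup_mkord _ (fun i => X i @^-1` ~` U)); exists i.
  have mED : measurable (word_event X A [::] `&` D) by exact: measurableI.
  have mCU : measurable (\big[setU/set0]_(i < n.+1) (X i @^-1` ~` U)).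
    exact: bigsetU_measurable.
  apply: (le_trans (measureU2 _ mED mCU)).
  have Boole : (P (\big[setU/set0]_(i < n.+1) (X i @^-1` ~` U)) <=
      \sum_(i < n.+1) P (X i @^-1` ~` U))%E.
    exact: (Boole_inequality P (A := fun i => X i @^-1` ~` U)).
  rewrite leeD2l//; apply: (le_trans Boole).
  under eq_bigr => i _ do rewrite (idX _ _ (borel_setC bU)).
  rewrite -[P _](fineK (fin_num_measure P _ (mC 0%N))) sumEFin.
  rewrite sumr_const card_ord -[fine _ *+ _]mulr_natl EFinM.
  by rewrite fineK ?fin_num_measure.
apply: (@le_trans _ _ (fine (P (word_event X A [::] `&` D)) +
    n.+1%:R * fine (P (X 0%N @^-1` ~` U)))).
  rewrite -lee_fin EFinD EFinM !fineK ?fin_num_measure//; exact: measurableI.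
rewrite lerD2r.
apply: (@tree_le_walk _ _ _ _ (fun s => fine (P (word_event X A s `&` D)))).
  by move=> s sn; rewrite (probability_word_event_rcons _ bX bA tA mG sn).
move=> s sn sm; case: ltP => [_|H]; last first.
  rewrite mulr0 (_ : _ `&` D = set0) ?measure0//.
  apply/seteqP; split=> // w [Ew [/ball_emp_mean Gw _]].
  have := word_event_sum_near x Ay Ew; rewrite sn.
  move: (_ - _ *: x) (\sum_(k <- s) _) H Gw => a b bH Gw ab.
  suff : `|b| < n.+1%:R * (r + e) by rewrite ltNge bH.
  have -> : b = a - (a - b) by rewrite subKr.
  by rewrite (le_lt_trans (ler_normB _ _))// mulrDr; lra.
rewrite mulr1 -lee_fin -(probability_word_event s bX indX idX bA).
rewrite fineK ?fin_num_measure//; last exact: measurableI.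
by rewrite le_measure ?inE//; exact: measurableI.
Qed.

End comparison.

(** * Continuous functionals, cells and exponential moments *)

Lemma borel_rv_measurable_fun (R : realType) (V : normedModType R) d
    (T : measurableType d) (Y : T -> V) (g : V -> R) :
  continuous g -> borel_rv Y -> measurable_fun setT (g \o Y).
Proof.
move=> /continuousP cg bY; apply: (measurability _ (RGenOpens.measurableE R)).
move=> _ [_ [a [b ->] <-]]; rewrite setTI comp_preimage.
by apply: bY; apply: open_borel_set; apply: cg; exact: interval_open.
Qed.

Lemma bounded_linear_continuous (R : realType) (V : normedModType R) (l : V -> R) M :
  (forall a u v, l (a *: u + v) = a * l u + l v) ->
  (forall v, `|l v| <= M * `|v|) -> continuous l.
Proof.
move=> ll lM x; apply/cvgrPdist_lt => e e0.
have M0 : 0 < `|M| + 1 by rewrite ltr_wpDl.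
have := nbhsx_ballx x _ (divr_gt0 e0 M0); rewrite -ball_normE => H.
near=> y; have -> : l x - l y = l (x - y).
  by rewrite [x - y]addrC -(scaleN1r y) ll mulN1r addrC.
apply: (le_lt_trans (lM _)); apply: (@le_lt_trans _ _ ((`|M| + 1) * `|x - y|)).
  by rewrite ler_wpM2r// (le_trans (ler_norm M))// lerDl.
rewrite mulrC -ltr_pdivlMr//; near: y.
exact: H.
Unshelve. all: by end_near. Qed.

Lemma continuous_linear_bounded (R : realType) (V : normedModType R) (l : V -> R) :
  (forall a u v, l (a *: u + v) = a * l u + l v) -> continuous l ->
  exists2 M, 0 <= M & forall v, `|l v| <= M * `|v|.
Proof.
move=> ll cl.
have l0 : l 0 = 0 by have := ll 1 0 0; rewrite scale1r addr0 mul1r; lra.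
have lZ a u : l (a *: u) = a * l u by rewrite -[a *: u]addr0 ll l0 addr0.
have /cvgrPdist_lt/(_ 1 ltr01)/nbhs_ballP[e /= e0 He] := cl 0.
exists (2 / e) => [|v]; first by rewrite divr_ge0// ltW.
have [->|v0] := eqVneq v 0; first by rewrite l0 !normr0 mulr0.
have nv0 : 0 < `|v| by rewrite normr_gt0.
have ev0 : 0 < e / 2 / `|v| by rewrite !divr_gt0.
have := He ((e / 2 / `|v|) *: v); rewrite -ball_normE /= sub0r normrN normrZ.
rewrite (gtr0_norm ev0) divfK ?gt_eqF// => Hl.
have /Hl : e / 2 < e by lra.
rewrite l0 sub0r normrN lZ normrM (gtr0_norm ev0) mulrC -ltr_pdivlMr// => /ltW H.
by apply: (le_trans H); rewrite div1r invf_div invf_div mulrC.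
Qed.

Section cells.
Context {R : realType} {V : normedModType R} {d : measure_display}
  {T : measurableType d} {P : probability T R}.
Implicit Types (Y : T -> V) (A : nat -> set V) (y : nat -> V).

Lemma countable_cells Y (e : R) : measurable_addition V -> borel_rv Y -> 0 < e ->
  exists A y, [/\ forall k, borel_set (A k), trivIset setT A,
    forall k v, A k v -> `|v - y k| < e &
    P (\bigcup_k (Y @^-1` A k)) = 1%E].
Proof.
move=> mD bY e0; have [y y1] := borel_rv_eventually_near_countable P mD bY e0.
exists (seqDU (fun k => ball (y k) e)), y; split=> [k||k v [+ _]|].
- apply: borel_setD; first by apply: open_borel_set; exact: ball_open.
  by apply: (@borel_set_bigsetU _ _ (fun k => ball (y k) e)) => i;
    apply: open_borel_set; exact: ball_open.
- exact: trivIset_seqDU.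
- by rewrite -ball_normE /= distrC.
- rewrite -preimage_bigcup; congr (P _ = _) : y1.
  by rewrite -preimage_bigcup seqDU_bigcup_eq.
Qed.

Lemma cells_tail Y A : borel_rv Y -> (forall k, borel_set (A k)) ->
  P (\bigcup_k (Y @^-1` A k)) = 1%E ->
  fine (P (Y @^-1` ~` \big[setU/set0]_(k < m) A k)) @[m --> \oo] --> 0.
Proof.
move=> bY bA PA.
pose F m := Y @^-1` \big[setU/set0]_(k < m) A k.
have mF m : measurable (F m) by apply: bY; exact: borel_set_bigsetU.
have UF : \bigcup_m F m = \bigcup_k (Y @^-1` A k).
  apply/seteqP; split=> w.
    by move=> [m _]; rewrite /F -(bigcup_mkord _ A) => -[k _ Ak]; exists k.
  by move=> [k _ Ak]; exists k.+1 => //; rewrite /F -(bigcup_mkord _ A); exists k => /=.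
have : P \o F @ \oo --> (1%:E : \bar R).
  rewrite -PA -UF; apply: nondecreasing_cvg_mu => //; first exact: bigcupT_measurable.
  move=> m n mn; apply/subsetPset; rewrite /F; apply: preimage_subset.
  by rewrite -!(bigcup_mkord _ A) => v [k km Ak]; exists k => //=; exact: leq_trans mn.
move=> /fine_cvgP[_ cF].
have -> : (fun m => fine (P (Y @^-1` ~` \big[setU/set0]_(k < m) A k))) =
    (fun m => 1 - fine (P (F m))).
  apply/funext => m; rewrite preimage_setC (probability_setC _ (mF m)).
  by rewrite fineB// ?fin_num_measure.
by rewrite -[X in _ --> X](subrr 1); apply: cvgB cF; exact: cvg_cst.
Qed.

Lemma cells_integral Y A (f : T -> \bar R) : borel_rv Y ->
  (forall k, borel_set (A k)) -> trivIset setT A ->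
  P (\bigcup_k (Y @^-1` A k)) = 1%E -> measurable_fun setT f ->
  (forall w, 0 <= f w)%E ->
  (\int[P]_w f w = \sum_(k <oo) \int[P]_(w in Y @^-1` A k) f w)%E.
Proof.
move=> bY bA tA PA mf f0.
have mA k : measurable (Y @^-1` A k) by exact: bY.
have mU : measurable (\bigcup_k (Y @^-1` A k)) by exact: bigcupT_measurable.
have PC : P (~` \bigcup_k (Y @^-1` A k)) = 0%E.
  by rewrite probability_setC// PA subee.
rewrite -ge0_integral_bigcup//; last 2 first.
- exact: measurable_funTS.
- by move=> i j _ _ [w [Ai Aj]]; apply: tA => //; exists (Y w).
rewrite (ge0_negligible_integral (measurableC mU) measurableT mf _ PC)//.
by rewrite setTD setCK.
Qed.

(** On each cell [l (Y w)] differs from [l (y k)] by at most [M * e], so the integral and its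
    discretisation agree up to a factor [expR (M * e)] either way. *)
Lemma cells_exp_moment Y A y (e M : R) (l : V -> R) :
  borel_rv Y -> (forall k, borel_set (A k)) -> trivIset setT A ->
  (forall k v, A k v -> `|v - y k| < e) ->
  P (\bigcup_k (Y @^-1` A k)) = 1%E -> 0 <= M ->
  (forall a u v, l (a *: u + v) = a * l u + l v) ->
  (forall v, `|l v| <= M * `|v|) ->
  let S m := \sum_(k < m) fine (P (Y @^-1` A k)) * expR (l (y k)) in
  let E := (\int[P]_w (expR (l (Y w)))%:E)%E in
  (forall m, (S m)%:E <= (expR (M * e))%:E * E)%E /\
  (forall c, (forall m, S m <= c) -> (E <= (expR (M * e) * c)%:E)%E).
Proof.
move=> bY bA tA Ay PA M0 ll lM S E.
have cl := bounded_linear_continuous ll lM.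
have mA k : measurable (Y @^-1` A k) by exact: bY.
have mf : measurable_fun setT (fun w => (expR (l (Y w)))%:E).
  apply/measurable_EFinP; apply: (@borel_rv_measurable_fun _ _ _ _ Y (fun v => expR (l v))) => // v.
  by apply: continuous_comp; [exact: cl|exact: continuous_expR].
have EE : E = (\sum_(k <oo) \int[P]_(w in Y @^-1` A k) (expR (l (Y w)))%:E)%E.
  by apply: cells_integral => // w; rewrite lee_fin expR_ge0.
have lB v u : l (v - u) = l v - l u.
  by rewrite [v - u]addrC -(scaleN1r u) ll mulN1r addrC.
have near k w : A k (Y w) -> `|l (Y w) - l (y k)| <= M * e.
  by move=> /Ay/ltW H; rewrite -lB (le_trans (lM _))// ler_wpM2l.
pose I k := (\int[P]_(w in Y @^-1` A k) (expR (l (Y w)))%:E)%E.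
have I0 k : (0 <= I k)%E by apply: integral_ge0 => w _; rewrite lee_fin expR_ge0.
have cst_int k c : (\int[P]_(w in Y @^-1` A k) c%:E)%E = (c * fine (P (Y @^-1` A k)))%:E.
  by rewrite integral_cst// EFinM fineK// fin_num_measure.
have Ilow k : ((fine (P (Y @^-1` A k)) * expR (l (y k)))%:E <= (expR (M * e))%:E * I k)%E.
  rewrite -lee_pdivrMl ?expR_gt0//;
  apply: (@le_trans _ _ (\int[P]_(w in Y @^-1` A k) (expR (l (y k) - M * e))%:E)%E).
    by rewrite cst_int expRD expRN -EFinM lee_fin [leLHS]mulrC -[leLHS]mulrA [leLHS]mulrC.
  apply: ge0_le_integral => //.
  - exact: measurable_funTS.
  - by move=> w /near; rewrite lee_fin ler_expR ler_norml => /andP[]; lra.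
have Iup k : (I k <= (expR (M * e))%:E * (fine (P (Y @^-1` A k)) * expR (l (y k)))%:E)%E.
  apply: (@le_trans _ _ (\int[P]_(w in Y @^-1` A k) (expR (l (y k) + M * e))%:E)%E).
    apply: ge0_le_integral => //.
    - exact: measurable_funTS.
    - by move=> w /near; rewrite lee_fin ler_expR ler_norml => /andP[]; lra.
  by rewrite cst_int expRD -EFinM lee_fin -mulrA [leLHS]mulrCA [fine _ * _]mulrC mulrCA.
split=> [m|c Sc].
  rewrite EE /S -sumEFin; apply: (@le_trans _ _ (\sum_(k < m) (expR (M * e))%:E * I k)%E).
    by apply: lee_sum => k _; exact: Ilow.
  rewrite -ge0_sume_distrr// lee_pmul2l ?lte_fin ?expR_gt0//.
  rewrite -(big_mkord xpredT I).
  by apply: nneseries_lim_ge => k _.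
rewrite EE; apply: lime_le; first by apply: is_cvg_nneseries => k _ _; exact: I0.
apply: nearW => m; rewrite big_mkord.
apply: (@le_trans _ _ (\sum_(k < m) ((expR (M * e))%:E *
    (fine (P (Y @^-1` A k)) * expR (l (y k)))%:E))%E).
  by apply: lee_sum => k _; exact: Iup.
by rewrite sumEFin -mulr_sumr lee_fin ler_wpM2l ?expR_ge0//; exact: Sc.
Qed.

End cells.

(** * Repeated blocks, the functional and the Chernoff bound *)

Lemma bernoulli_expr (R : realType) (a : R) n : 1 <= a -> 1 + n%:R * (a - 1) <= a ^+ n.
Proof.
move=> a1; elim: n => [|n IH]; first by rewrite mul0r addr0 expr0.
rewrite exprS; apply: (@le_trans _ _ (a * (1 + n%:R * (a - 1)))); last first.
  by rewrite ler_wpM2l// (le_trans ler01).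
have : 0 <= n%:R * (a - 1) * (a - 1) by rewrite !mulr_ge0 ?subr_ge0.
rewrite -natr1; set z : R := n%:R; lra.
Qed.

Section walk_lower_bounds.
Context {R : realType} {V : normedModType R}.
Implicit Types (p : nat -> R) (y : nat -> V).

Lemma walk_cst1 p y m n v : walk p y m n (fun=> 1) v = (\sum_(k < m) p k) ^+ n.
Proof.
elim: n v => [|n IH] v; first by rewrite expr0.
by rewrite walkS exprS mulr_suml; apply: eq_bigr => k _; rewrite IH.
Qed.

Lemma walk_indic_expr_le p y m n v k : (forall k, 0 <= p k) ->
  walk p y m n (point_indic v) 0 ^+ k <= walk p y m (k * n) (point_indic (v *+ k)) 0.
Proof.
move=> p0; elim: k => [|k IH].
  by rewrite expr0 mul0n mulr0n /walk /= /point_indic eqxx.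
rewrite exprS mulSn mulrS (le_trans _ (walk_indicD_ge _ _ _ _ _ _ p0))//.
by rewrite ler_wpM2l// walk_ge0// => u; exact: ler0n.
Qed.

(* [k] blocks of [n] steps summing up to [v] each, then [j] arbitrary steps. *)
Lemma walk_ball_ge p y m n v k j (r : R) : (forall k, 0 <= p k) -> (j <= n)%N ->
  k%:R * `|v| + n%:R * (\sum_(i < m) `|y i|) < r ->
  walk p y m n (point_indic v) 0 ^+ k * (\sum_(i < m) p i) ^+ j <=
  walk p y m (k * n + j) (fun u => (`|u| < r)%R%:R) 0.
Proof.
move=> p0 jn small; have b0 (u : V) : 0 <= (`|u| < r)%R%:R :> R by exact: ler0n.
apply: le_trans (walk_indic_mul_le _ _ _ _ (v *+ k) p0 b0).
apply: ler_pM; first by rewrite exprn_ge0// walk_ge0// => u; exact: ler0n.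
- by rewrite exprn_ge0// sumr_ge0.
- exact: walk_indic_expr_le.
rewrite -(walk_cst1 p y m j (v *+ k)); apply: le_walk_support => // c cj.
rewrite (_ : _ < r) //; apply: le_lt_trans small.
apply: (le_trans (ler_normD _ _)); rewrite normrMn mulr_natl lerD2l.
apply: (le_trans (ler_norm_sum _ _ _)); rewrite mulr_sumr; apply: ler_sum => i _.
by rewrite normrMn -[_ *+ _]mulr_natl ler_wpM2r// ler_nat (leq_trans (cj i)).
Qed.

End walk_lower_bounds.

Section functional.
Context {R : realType} {V : normedModType R} {d : measure_display}
  {T : measurableType d} {P : probability T R}.
Implicit Types (X : nat -> T -> V) (A : nat -> set V) (y : nat -> V).

Lemma cells_mass_le1 (Y : T -> V) A m : borel_rv Y -> (forall k, borel_set (A k)) ->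
  trivIset setT A -> \sum_(k < m) fine (P (Y @^-1` A k)) <= 1.
Proof.
move=> bY bA tA; have mA k : measurable (Y @^-1` A k) by exact: bY.
rewrite sum_fine => [|k _]; last exact: fin_num_measure.
rewrite -(measure_bigsetU P (F := fun k => Y @^-1` A k))//; last first.
  by move=> i j _ _ [w [Ai Aj]]; apply: tA => //; exists (Y w).
rewrite -lee_fin fineK ?fin_num_measure//; last exact: bigsetU_measurable.
by apply: probability_le1; exact: bigsetU_measurable.
Qed.

(** Were the mass [q] larger than [expR (n%:R * c)], repeating the block [k] times would make the
    ball too likely at every late time [N.+1]. The radius splits in thirds: the drift [v *+ k], the
    leftover steps, and the rounding. *)
Lemma walk_indic_le_expR X A y (e r c : R) x m n v :
  measurable_addition V -> (forall i, borel_rv (X i)) ->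
  mutually_independent P X -> identically_distributed P X ->
  (forall k, borel_set (A k)) -> trivIset setT A ->
  (forall k v, A k v -> `|v - y k| < e) ->
  0 < r -> e <= r / 3 -> c <= 0 -> (0 < n)%N -> `|v| < n%:R * (r / 3) ->
  (forall N0, exists2 N, (N0 <= N)%N &
    fine (P (emp_mean X N.+1 @^-1` ball x r)) < expR (N.+1%:R * c)) ->
  walk (fun k => fine (P (X 0%N @^-1` A k))) (fun k => y k - x) m n
    (point_indic v) 0 <= expR (n%:R * c).
Proof.
move=> mD bX indX idX bA tA Ay r0 er c0 n0 vn freq.
set p := fun k => _; set y' := fun k => _ - _; set q := walk _ _ _ _ _ _.
have p0 k : 0 <= p k by rewrite fine_ge0.
pose a := \sum_(k < m) p k.
have a1 : a <= 1 by exact: cells_mass_le1.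
have a0 : 0 <= a by exact: sumr_ge0.
have qa : q <= a ^+ n.
  by rewrite -(walk_cst1 p y' m n 0); apply: le_walk => // u; rewrite /point_indic; case: eqP.
rewrite leNgt; apply/negP => bq.
set b := expR _ in bq; have b0 : 0 < b := expR_gt0 _.
have an0 : 0 < a ^+ n by rewrite (lt_le_trans _ qa)// (lt_trans b0).
pose rho := q / b.
have rho1 : 1 < rho by rewrite ltr_pdivlMr// mul1r.
pose B := \sum_(i < m) `|y' i|.
(* Beyond [K] blocks, Bernoulli's inequality makes [rho ^+ k] exceed the inverse of [a ^+ n], which
   pays for the leftover steps. *)
pose K := Num.truncn ((a ^+ n)^-1 / (rho - 1)).
(* The first term forces more than [K] blocks, the second bounds the leftover displacement
   [n%:R * B] by a third of the radius. *)
pose N0 := (K.+1 * n + Num.truncn (n%:R * B / (r / 3)))%N.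
have [N NN0] := freq N0; rewrite ltNge => /negP; apply.
pose k := (N.+1 %/ n)%N; pose j := (N.+1 %% n)%N.
have Nkj : N.+1 = (k * n + j)%N by exact: divn_eq.
have Kk : (K < k)%N.
  by rewrite /k leq_divRL// (leq_trans _ (leqW NN0))// leq_addr.
have jn : (j <= n)%N by rewrite ltnW// ltn_mod.
have r30 : 0 < r / 3 by rewrite divr_gt0.
apply: le_trans (emp_mean_ball_ge_walk r x m N mD bX indX idX bA tA Ay).
rewrite -/p -/y' [in walk _ _ _ _]Nkj.
have small : k%:R * `|v| + n%:R * B < N.+1%:R * (r - e).
  have h1 : k%:R * `|v| <= N.+1%:R * (r / 3).
    apply: (@le_trans _ _ (k%:R * (n%:R * (r / 3)))); first by rewrite ler_wpM2l// ltW.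
    by rewrite mulrA ler_wpM2r ?(ltW r30)// -natrM ler_nat Nkj leq_addr.
  have h2 : n%:R * B < N.+1%:R * (r / 3).
    rewrite -ltr_pdivrMr//; apply: (lt_le_trans (truncnS_gt _)).
    by rewrite ler_nat ltnS (leq_trans _ NN0)// leq_addl.
  have h3 : N.+1%:R * (r / 3) + N.+1%:R * (r / 3) <= N.+1%:R * (r - e).
    by rewrite -mulrDr ler_wpM2l//; lra.
  by apply: lt_le_trans h3; exact: ler_ltD.
apply: le_trans (walk_ball_ge p0 jn small).
rewrite -/q -/a.
(* Since [c <= 0], dropping the [j] leftover steps from the exponent only increases the
   exponential. *)
apply: (@le_trans _ _ (b ^+ k)).
  rewrite /b -expRM_natl ler_expR mulrA -natrM ler_wnM2r// ler_nat Nkj leq_addr//.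
apply: (@le_trans _ _ (q ^+ k * a ^+ n)); last first.
  rewrite ler_wpM2l ?exprn_ge0 ?(ltW (lt_trans b0 bq))// ler_wiXn2l//.
have -> : q = rho * b by rewrite /rho divfK// gt_eqF.
rewrite exprMn mulrAC ler_peMl ?exprn_ge0 ?(ltW b0)//.
rewrite -ler_pdivrMr// mul1r (le_trans _ (bernoulli_expr k (ltW rho1)))//.
have : (a ^+ n)^-1 < K.+1%:R * (rho - 1).
  by rewrite -ltr_pdivrMr ?subr_gt0//; exact: truncnS_gt.
have : K.+1%:R * (rho - 1) <= k%:R * (rho - 1).
  by rewrite ler_wpM2r ?subr_ge0 ?(ltW rho1)// ler_nat.
by lra.
Qed.

(** [M] is chosen so that [c * n%:R + M * t >= 0] as soon as [t >= n%:R * (r / 3)]: far points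
    satisfy the exponential bound because masses are at most 1, near points by [walk_indic_le_expR].
    Undoing the centring produces [l x], and the cells cost [M * e]. *)
Lemma emp_mean_functional X (e r c : R) x :
  measurable_addition V -> (forall i, borel_rv (X i)) ->
  mutually_independent P X -> identically_distributed P X ->
  0 < e -> 0 < r -> e <= r / 3 -> c <= 0 ->
  (forall N0, exists2 N, (N0 <= N)%N &
    fine (P (emp_mean X N.+1 @^-1` ball x r)) < expR (N.+1%:R * c)) ->
  let M := - c / (r / 3) in
  exists l : V -> R, [/\ forall a u v, l (a *: u + v) = a * l u + l v,
    forall v, `|l v| <= M * `|v| &
    (\int[P]_w (expR (l (X 0%N w)))%:E <= (expR (l x + c + M * e))%:E)%E].
Proof.
move=> mD bX indX idX e0 r0 er c0 freq M.
have [A [y [bA tA Ay PA]]] := countable_cells (P := P) mD (bX 0%N) e0.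
set p := fun k => fine (P (X 0%N @^-1` A k)).
have p0 k : 0 <= p k by rewrite /p fine_ge0.
have r30 : 0 < r / 3 by rewrite divr_gt0.
have M0 : 0 <= M by rewrite divr_ge0 ?oppr_ge0// ltW.
have [|l [ll lM lS]] := @walk_exponential_functional _ _ p (fun k => y k - x) M c M0 p0.
  move=> m n v; have [vn|nv] := ltP `|v| (n%:R * (r / 3)).
    case: n vn => [|n] vn; first by move: vn; rewrite mul0r normr_lt0.
    apply: (le_trans (walk_indic_le_expR m mD bX indX idX bA tA Ay r0 er c0 _ vn freq)) => //.
    by rewrite ler_expR mulrC lerDl mulr_ge0.
  apply: (@le_trans _ _ 1).
    apply: (@le_trans _ _ ((\sum_(k < m) p k) ^+ n)).
      rewrite -(walk_cst1 p (fun k => y k - x) m n 0); apply: le_walk => // u.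
      by rewrite /point_indic; case: eqP.
    by rewrite exprn_ile1 ?sumr_ge0//; exact: cells_mass_le1.
  rewrite -[leLHS]expR0 ler_expR.
  have : n%:R * (- c) <= M * `|v|.
    have -> : n%:R * (- c) = M * (n%:R * (r / 3)).
      by rewrite mulrCA /M divfK ?gt_eqF.
    by rewrite ler_wpM2l.
  by rewrite mulrN [c * _]mulrC; lra.
exists l; split=> //.
have [_ H] := cells_exp_moment (bX 0%N) bA tA Ay PA M0 ll lM.
apply: (le_trans (H (expR (l x + c)) _)) => [m|]; last first.
  by rewrite -expRD lee_fin ler_expR; lra.
rewrite expRD -ler_pdivrMl ?expR_gt0//; apply: le_trans (lS m).
rewrite mulr_sumr; apply: ler_sum => k _.
have -> : l (y k - x) = - l x + l (y k) by rewrite addrC -(scaleN1r x) ll mulN1r.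
by rewrite expRD expRN mulrCA.
Qed.

(** The exponential Markov inequality is applied to the finite walk, where the moment of the sum
    factors algebraically; then [m] tends to infinity and [e] to 0. The error [2 * M * e] per step
    comes half from the enlarged radius, half from the discretised moment. *)
Lemma emp_mean_chernoff X (b M r : R) (l : V -> R) x n :
  measurable_addition V -> (forall i, borel_rv (X i)) ->
  mutually_independent P X -> identically_distributed P X -> 0 <= M ->
  (forall a u v, l (a *: u + v) = a * l u + l v) ->
  (forall v, `|l v| <= M * `|v|) ->
  (\int[P]_w (expR (l (X 0%N w)))%:E <= (expR b)%:E)%E ->
  fine (P (emp_mean X n.+1 @^-1` ball x r)) <= expR (n.+1%:R * (b - l x + M * r)).
Proof.
move=> mD bX indX idX M0 ll lM Eb.
have lD u v : l (u + v) = l u + l v by rewrite -[u]scale1r ll mul1r scale1r.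
have l0 : l 0 = 0 by have := lD 0 0; rewrite addr0; lra.
suff main e : 0 < e -> fine (P (emp_mean X n.+1 @^-1` ball x r)) <=
    expR (n.+1%:R * (b - l x + M * r) + n.+1%:R * (2 * M) * e).
  set Q := fine _ in main *; have [Q0|Q0] := ltP 0 Q; last first.
    by rewrite (le_trans Q0)// expR_ge0.
  rewrite -(lnK (Q0 : Q \is Num.pos)) ler_expR; apply/ler_addgt0Pr => t t0.
  set D : R := n.+1%:R * (2 * M) in main *; have D0 : 0 <= D by rewrite !mulr_ge0.
  have D1 : 0 < D + 1 by rewrite ltr_wpDl.
  have := main (t / (D + 1)) (divr_gt0 t0 D1).
  rewrite -{1}(lnK (Q0 : Q \is Num.pos)) ler_expR => H; apply: (le_trans H).
  by rewrite lerD2l mulrA ler_pdivrMr// mulrC ler_wpM2l ?(ltW t0)// lerDl.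
move=> e0; have [A [y [bA tA Ay PA]]] := countable_cells (P := P) mD (bX 0%N) e0.
set p := fun k => fine (P (X 0%N @^-1` A k)).
have p0 k : 0 <= p k by rewrite /p fine_ge0.
have [H _] := cells_exp_moment (bX 0%N) bA tA Ay PA M0 ll lM.
set bound := expR _.
have walk_le m : walk p (fun k => y k - x) m n.+1
    (fun v => (`|v| < n.+1%:R * (r + e))%R%:R) 0 <= bound.
  apply: (@le_trans _ _ (walk p (fun k => y k - x) m n.+1
      (fun v => expR (M * (n.+1%:R * (r + e))) * expR (l v)) 0)).
    apply: le_walk => // v; case: ltP => [vr|_]; last by rewrite mulr_ge0 ?expR_ge0.
    rewrite -expRD -[leLHS]expR0 ler_expR.
    have := lM v; have := ler_wpM2l M0 (ltW vr).
    by rewrite ler_norml => h1 /andP[h2 _]; lra.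
  rewrite walkZ walk_expR// l0 expR0 mulr1.
  have -> : \sum_(k < m) p k * expR (l (y k - x)) =
      expR (- l x) * \sum_(k < m) p k * expR (l (y k)).
    rewrite mulr_sumr; apply: eq_bigr => k _; rewrite mulrCA -expRD.
    by rewrite [y k - x]addrC lD -(scaleN1r x) -[-1 *: x]addr0 ll l0 addr0 mulN1r.
  have Sb : \sum_(k < m) p k * expR (l (y k)) <= expR (M * e + b).
    rewrite -lee_fin (le_trans (H m))// expRD EFinM lee_pmul2l ?lte_fin ?expR_gt0//.
  apply: (@le_trans _ _ (expR (M * (n.+1%:R * (r + e))) *
      (expR (- l x) * expR (M * e + b)) ^+ n.+1)).
    rewrite ler_wpM2l ?expR_ge0// lerXn2r ?nnegrE ?mulr_ge0 ?expR_ge0//.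
      by apply: sumr_ge0 => k _; rewrite mulr_ge0 ?expR_ge0.
    by rewrite ler_wpM2l// expR_ge0.
  rewrite -expRD -expRM_natl -expRD /bound ler_expR.
  by rewrite le_eqVlt; apply/orP; left; apply/eqP; ring.
have tail := cells_tail (bX 0%N) bA PA.
have lim_bound : (bound + n.+1%:R * fine (P (X 0%N @^-1` ~` \big[setU/set0]_(k < m) A k)))
    @[m --> \oo] --> bound.
  rewrite -[X in _ --> X]addr0 -[X in _ --> _ + X](mulr0 n.+1%:R).
  by apply: cvgD; [exact: cvg_cst|apply: cvgM => //; exact: cvg_cst].
rewrite -(cvg_lim (@Rhausdorff R) lim_bound).
apply: limr_ge; first by apply/cvg_ex; exists bound.
apply: nearW => m.
apply: (le_trans (emp_mean_ball_le_walk r x m n mD bX indX idX bA tA Ay)).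
by rewrite lerD2r; exact: walk_le.
Qed.

End functional.

(** * Extended logarithm, limits inferior and superior *)

Lemma elog_le (R : realType) (x : \bar R) (b : R) :
  (elog x <= b%:E)%E = (x <= (expR b)%:E)%E.
Proof.
case: x => [r| |] //=; last by rewrite !leNye.
case: ltP => [r0|r0]; first by rewrite !lee_fin -[in RHS](lnK r0) ler_expR.
by rewrite leNye lee_fin (le_trans r0)// expR_ge0.
Qed.

Lemma elog_lt_expR (R : realType) (r b : R) :
  (elog r%:E < b%:E)%E -> r < expR b.
Proof.
rewrite /=; have [r0|r0 _] := ltP 0 r; last by rewrite (le_lt_trans r0)// expR_gt0.
by rewrite lte_fin -[in X in _ -> X](lnK r0) ltr_expR.
Qed.

Lemma le_elog (R : realType) (x y : \bar R) : (x <= y)%E -> (elog x <= elog y)%E.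
Proof.
case: x y => [x| |] [y| |] //; rewrite ?leey ?leNye//=.
rewrite lee_fin => xy; have [x0|_] := ltP 0 x; last by rewrite leNye.
by rewrite (lt_le_trans x0 xy) lee_fin ler_ln// posrE (lt_le_trans x0).
Qed.

Lemma lee_of_forall_gt (R : realType) (a b : \bar R) :
  (forall c : R, (a < c%:E)%E -> (b <= c%:E)%E) -> (b <= a)%E.
Proof.
case: a => [a| |] H; last 2 first.
- by rewrite leey.
- case: b H => [b| |] H //.
    by have := H (b - 1) (ltNyr _); rewrite lee_fin => ?; exfalso; lra.
  by have := H 0 (ltNyr _).
apply/lee_addgt0Pr => e e0; rewrite -EFinD; apply: H.
by rewrite lte_fin ltrDl.
Qed.

Lemma limn_einfE (R : realType) (u : (\bar R)^nat) :
  limn_einf u = ereal_sup (range (einfs u)).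
Proof. by rewrite limn_einf_lim; apply/cvg_lim => //; exact: cvg_einfs_sup. Qed.

Lemma limn_esupE (R : realType) (u : (\bar R)^nat) :
  limn_esup u = ereal_inf (range (esups u)).
Proof. by rewrite limn_esup_lim; apply/cvg_lim => //; exact: cvg_esups_inf. Qed.

Lemma limn_einf_le (R : realType) (u : (\bar R)^nat) (b : \bar R) :
  (forall n, (u n <= b)%E) -> (limn_einf u <= b)%E.
Proof.
move=> ub; rewrite limn_einfE; apply: ge_ereal_sup => _ [n _ <-].
by apply: le_trans (ub n); apply: ereal_inf_lbound; exists n => /=.
Qed.

Lemma le_limn_einf_seq (R : realType) (u v : (\bar R)^nat) :
  (forall n, (u n <= v n)%E) -> (limn_einf u <= limn_einf v)%E.
Proof.
move=> uv; rewrite !limn_einfE; apply: ge_ereal_sup => _ [n _ <-].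
apply: (@le_trans _ _ (einfs v n)); last by apply: ereal_sup_ubound; exists n.
apply: le_ereal_inf_tmp => _ [k nk <-]; apply: le_trans (uv k).
by apply: ereal_inf_lbound; exists k.
Qed.

Lemma limn_einf_lt_frequently (R : realType) (u : (\bar R)^nat) (c : \bar R) N0 :
  (limn_einf u < c)%E -> exists2 N, (N0 <= N)%N & (u N < c)%E.
Proof.
rewrite limn_einfE => uc.
have : (einfs u N0 < c)%E by apply: le_lt_trans uc; apply: ereal_sup_ubound; exists N0.
by move=> /ereal_inf_lt[_ [N N0N <-] uN]; exists N.
Qed.

Lemma limn_esup_le_eventually (R : realType) (u : (\bar R)^nat) (b : \bar R) N0 :
  (forall n, (N0 <= n)%N -> (u n <= b)%E) -> (limn_esup u <= b)%E.
Proof.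
move=> ub; rewrite limn_esupE; apply: (@le_trans _ _ (esups u N0)).
  by apply: ereal_inf_lbound; exists N0.
by apply: ge_ereal_sup => _ [n N0n <-]; exact: ub.
Qed.

(** * Entropy, Legendre transform and the two large deviation bounds *)

Section large_deviations.
Context {R : realType} {V : normedModType R} {d : measure_display}
  {T : measurableType d} {P : probability T R}.
Implicit Types (X : nat -> T -> V) (x : V).

Lemma ld_seq_le X G n (b : R) :
  (ld_seq P X G n <= b%:E)%E =
  (P (emp_mean X n.+1 @^-1` G) <= (expR (n.+1%:R * b))%:E)%E.
Proof. by rewrite /ld_seq lee_pdivrMl// -EFinM elog_le. Qed.

Lemma ld_seq_lt X G n (b : R) : measurable (emp_mean X n.+1 @^-1` G) ->
  (ld_seq P X G n < b%:E)%E ->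
  fine (P (emp_mean X n.+1 @^-1` G)) < expR (n.+1%:R * b).
Proof.
move=> mG; rewrite /ld_seq lte_pdivrMl// -EFinM -{1}(fineK (fin_num_measure P _ mG)).
exact: elog_lt_expR.
Qed.

Lemma le_ld_seq X G H n : measurable (emp_mean X n.+1 @^-1` G) ->
  measurable (emp_mean X n.+1 @^-1` H) -> G `<=` H ->
  (ld_seq P X G n <= ld_seq P X H n)%E.
Proof.
move=> mG mH GH; rewrite /ld_seq lee_pmul2l ?lte_fin// le_elog// le_measure ?inE//.
exact: preimage_subset.
Qed.

Section iid.
Variable X : nat -> T -> V.
Hypotheses (mD : measurable_addition V) (bX : forall i, borel_rv (X i))
  (indX : mutually_independent P X) (idX : identically_distributed P X).

Let measurable_emp_mean n G : borel_set G -> measurable (emp_mean X n @^-1` G).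
Proof. by apply: borel_rv_emp_mean. Qed.

Let borel_ball x (r : R) : borel_set (ball x r).
Proof. by apply: open_borel_set; exact: ball_open. Qed.

Lemma ld_seq_ball_le (l : V -> R) x (b a : R) : top_dual l ->
  (log_mgf P X l <= b%:E)%E -> b - l x < a ->
  exists2 r : R, 0 < r & forall n, (ld_seq P X (ball x r) n <= a%:E)%E.
Proof.
move=> [ll cl] lb ba; have [M M0 lM] := continuous_linear_bounded ll cl.
have M1 : 0 < M + 1 by rewrite ltr_wpDl.
(* This radius [r] gives [M * r <= a - (b - l x)]; [M + 1] keeps the divisor positive. *)
exists ((a - (b - l x)) / (M + 1)) => [|n]; first by rewrite divr_gt0// subr_gt0.
rewrite ld_seq_le -[P _](fineK (fin_num_measure P _ (measurable_emp_mean _ (borel_ball _ _)))).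
rewrite lee_fin (le_trans (emp_mean_chernoff (b := b) _ x n mD bX indX idX M0 ll lM _))//.
  by rewrite -elog_le.
rewrite ler_expR ler_wpM2l// -lerBrDl mulrA ler_pdivrMr// mulrC ler_wpM2l ?lerDl//.
by rewrite ltW// subr_gt0.
Qed.

Lemma entropy_le_legendre x : (entropy P X x <= - legendre P X x)%E.
Proof.
rewrite leeNr; apply: ge_ereal_sup => _ [l lV <-].
suff H (b : R) : (log_mgf P X l <= b%:E)%E -> (entropy P X x <= (b - l x)%:E)%E.
  case E : (log_mgf P X l) H => [b| |] H.
  - by rewrite leeNr -EFinB -EFinN opprB; apply: H.
  - by rewrite addeNy leNye.
  (* Here every real [b] is admissible in [H], so the entropy is below every real. *)
  - suff -> : entropy P X x = -oo%E by rewrite leey.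
    apply/eqP; rewrite -leeNy_eq; apply: lee_of_forall_gt => c _.
    by rewrite -[c](addrK (l x)); apply: H; rewrite leNye.
move=> lb; apply: lee_of_forall_gt => a; rewrite lte_fin => ba.
have [r r0 ldr] := ld_seq_ball_le lV lb ba.
apply: (@le_trans _ _ (limn_einf (ld_seq P X (ball x r)))).
  by apply: ereal_inf_lbound; exists r.
exact: limn_einf_le.
Qed.

Lemma legendre_ge0 x : (0 <= legendre P X x)%E.
Proof.
apply: ereal_sup_ubound; exists (fun=> 0).
  by split=> [a u v|]; [rewrite mulr0 addr0|exact: cst_continuous].
have int1 : (\int[P]_w (expR (0 : R))%:E = 1)%E.
  by rewrite expR0 integral_cst// mul1e; exact: probability_setT.
rewrite /log_mgf int1 /= ltr01 ln1.
by rewrite subee.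
Qed.

Lemma legendre_le_entropy x : (- legendre P X x <= entropy P X x)%E.
Proof.
apply: le_ereal_inf_tmp => _ [r /= r0 <-]; apply: lee_of_forall_gt => c Lc.
(* A positive [c] already exceeds [- legendre], which is at most 0 thanks to the zero functional;
   the rest may assume [c <= 0], as [emp_mean_functional] demands. *)
have [c0|c0] := ltP 0 c.
  by rewrite leeNl (le_trans _ (legendre_ge0 x))// -EFinN lee_fin oppr_le0 ltW.
have freq N0 : exists2 N, (N0 <= N)%N &
    fine (P (emp_mean X N.+1 @^-1` ball x r)) < expR (N.+1%:R * c).
  have [N N0N LN] := limn_einf_lt_frequently N0 Lc; exists N => //.
  by apply: ld_seq_lt => //; apply: measurable_emp_mean; exact: borel_ball.
pose M := - c / (r / 3).
have r30 : 0 < r / 3 by rewrite divr_gt0.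
have M0 : 0 <= M by rewrite divr_ge0 ?oppr_ge0// ltW.
have M1 : 0 < M + 1 by rewrite ltr_wpDl.
apply/lee_addgt0Pr => t t0.
(* The first bound keeps the rounding within a third of the radius, the second keeps its cost
   [M * e] below [t]. *)
pose e := Num.min (r / 3) (t / (M + 1)).
have e0 : 0 < e by rewrite lt_min r30 divr_gt0.
have er : e <= r / 3 by rewrite ge_min lexx.
have Me : M * e <= t.
  apply: (@le_trans _ _ (M * (t / (M + 1)))).
    by rewrite ler_wpM2l// ge_min lexx orbT.
  by rewrite mulrA ler_pdivrMr// mulrC ler_wpM2l ?(ltW t0)// lerDl.
have [l [ll lM lE]] := emp_mean_functional mD bX indX idX e0 r0 er c0 freq.
rewrite -/M in lM lE.
have : (log_mgf P X l <= (l x + c + M * e)%:E)%E by rewrite /log_mgf elog_le.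
move=> /(leeB (lexx (l x)%:E)) H.
rewrite leeNl -EFinD -EFinN; apply: (@le_trans _ _ ((l x)%:E - log_mgf P X l)%E).
  apply: le_trans H; rewrite -EFinB lee_fin; lra.
apply: ereal_sup_ubound; exists l => //; split=> //.
exact: bounded_linear_continuous lM.
Qed.

Lemma entropy_eq_legendre x : entropy P X x = (- legendre P X x)%E.
Proof.
by apply/eqP; rewrite eq_le entropy_le_legendre legendre_le_entropy.
Qed.

Lemma ld_lower_bound G : borel_set G ->
  (ereal_sup (entropy P X @` interior G) <= limn_einf (ld_seq P X G))%E.
Proof.
move=> bG; apply: ge_ereal_sup => _ [x /nbhs_ballP[r /= r0 rG] <-].
apply: (@le_trans _ _ (limn_einf (ld_seq P X (ball x r)))).
  by apply: ereal_inf_lbound; exists r.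
apply: le_limn_einf_seq => n; apply: le_ld_seq => //; exact: measurable_emp_mean.
Qed.

Lemma ld_upper_bound K : borel_set K -> compact (closure K) ->
  (limn_esup (ld_seq P X K) <= ereal_sup (entropy P X @` closure K))%E.
Proof.
move=> bK cK; apply: lee_of_forall_gt => a sa.
(* Since [- legendre] at [x] is below [a], some functional witnesses it, and the Chernoff bound then
   holds on a whole ball around [x]. Outside the closure the radius 0 is a dummy. *)
have /choice[rr rrP] x : exists r : R, closure K x ->
    0 < r /\ forall n, (ld_seq P X (ball x r) n <= a%:E)%E.
  have [Kx|nK] := pselect (closure K x); last by exists 0.
  have : (entropy P X x < a%:E)%E.
    by apply: le_lt_trans sa; apply: ereal_sup_ubound; exists x.
  rewrite entropy_eq_legendre lteNl -EFinN => /ereal_sup_gt[_ [l lV <-]].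
  case E : (log_mgf P X l) => [b| |] // H.
    have [||r r0 rP] := @ld_seq_ball_le l x b a lV; first by rewrite E.
      by move: H; rewrite -EFinB lte_fin; lra.
    by exists r.
  have [||r r0 rP] := @ld_seq_ball_le l x (a + l x - 1) a lV.
  - by rewrite E leNye.
  - by lra.
  - by exists r.
move: cK; rewrite compact_cover => /(_ V (closure K) (fun x => ball x (rr x))).
case=> [x Kx|x Kx|D' D'K KD']; first exact: ball_open.
  by exists x => //; apply: ballxx; have [] := rrP _ Kx.
pose D := finmap.enum_fset D'.
have PK n : (P (emp_mean X n.+1 @^-1` K) <= ((size D)%:R * expR (n.+1%:R * a))%:E)%E.
  have mB x : measurable (emp_mean X n.+1 @^-1` ball x (rr x)).
    by apply: measurable_emp_mean; exact: borel_ball.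
  apply: (@le_trans _ _ (P (\big[setU/set0]_(x <- D) (emp_mean X n.+1 @^-1` ball x (rr x))))).
    rewrite le_measure ?inE//; [exact: measurable_emp_mean|exact: bigsetU_measurable|].
    move=> w /subset_closure/KD'[x xD' xw]; rewrite -bigcup_seq; by exists x.
  have DP x : x \in D -> (P (emp_mean X n.+1 @^-1` ball x (rr x)) <= (expR (n.+1%:R * a))%:E)%E.
    by move=> xD; rewrite -ld_seq_le; apply: (rrP x _).2; apply/set_mem/D'K.
  elim: D DP {KD'} => [|x s IH] DP; first by rewrite big_nil measure0 mul0r.
  rewrite big_cons.
  have mU : measurable (\big[setU/set0]_(x <- s) (emp_mean X n.+1 @^-1` ball x (rr x))).
    exact: bigsetU_measurable.
  apply: (le_trans (measureU2 P (mB x) mU)).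
  rewrite /= -natr1 mulrDl mul1r [_ * _ + _]addrC EFinD leeD//.
    by apply: DP; rewrite mem_head.
  by apply: IH => y ys; apply: DP; rewrite in_cons ys orbT.
apply/lee_addgt0Pr => t t0; rewrite -EFinD.
(* From this rank on, the number of balls is at most [n.+1%:R * t], hence at most its exponential,
   and is absorbed by the margin [t]. *)
apply: (@limn_esup_le_eventually _ _ _ (Num.truncn ((size D)%:R / t))) => n nN.
rewrite ld_seq_le (le_trans (PK n))// lee_fin mulrDr expRD mulrC ler_wpM2l ?expR_ge0//.
apply: le_trans (expR_ge1Dx _).
have : (size D)%:R / t < n.+1%:R :> R.
  by apply: (lt_le_trans (truncnS_gt _)); rewrite ler_nat.
by rewrite ltr_pdivrMr//; lra.
Qed.

End iid.

End large_deviations.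

Theorem theorem4p6 (R : realType) (V : normedModType R)
    (d : measure_display) (T : measurableType d) (P : probability T R)
    (X : nat -> T -> V) :
  measurable_addition V ->
  (forall i, borel_rv (X i)) ->
  mutually_independent P X ->
  identically_distributed P X ->
  weak_LDP P X (entropy P X) /\
  (forall x, entropy P X x = (- legendre P X x)%E).
Proof.
move=> mD bX indX idX; split; last exact: entropy_eq_legendre.
by split=> [G|K]; [exact: ld_lower_bound|exact: ld_upper_bound].
Qed.
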